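(* Let $z_0=0,z_1,\dots,z_s$ be distinct points of $\mathbb{D}$, let $d_0\ge0$ and $m_1,\dots,m_s\ge1$ be integers, and let $b(z)=z^{d_0}\prod_{j=1}^s\Big(\frac{z-z_j}{1-\overline{z_j}z}\Big)^{m_j}$. Let $B=f_0+f_1+\dots+f_s$ be $\mathcal{H}^2_{\omega}$-inner, where $f_0$ is a polynomial of degree $d_0$ and $f_j\in\mathcal{X}_{z_j}$ has degree $m_j-1$ for $1\le j\le s$ (an $\mathcal{H}^2_{\omega}$-analogue of $b$). Then $B/b$ (extended holomorphically across the zeros of $b$) belongs to $\mathcal{H}^2_{\omega}(|b|^2)$ and is a constant multiple of the reproducing kernel of $\mathcal{H}^2_{\omega}(|b|^2)$ at the origin.
   Context: Let $\omega=\{\omega_n\}_{n\geq 0}$ be a sequence of positive reals with $\omega_0=1$ and $\lim_{n\to\infty}\omega_{n+1}/\omega_n=1$. $\mathcal{H}^2_{\omega}$ is the Hilbert space of power series $f(z)=\sum_{n\ge0}a_nz^n$ with $\|f\|^2=\sum_{n\geq0}\omega_n|a_n|^2<\infty$ and inner product $\langle f,g\rangle=\sum_n\omega_na_n\overline{b_n}$; it is a reproducing kernel Hilbert space on the unit disk $\mathbb{D}$ with kernel $K_\lambda(z)=\sum_{n\ge0}\overline{\lambda}^nz^n/\omega_n$. For $\ell\ge0$, $K^{(\ell)}_\lambda(z)=\frac{\partial^\ell}{\partial\overline{\lambda}^\ell}K_\lambda(z)$; $\mathcal{X}_\lambda$ is the linear span of $\{K_\lambda,K^{(1)}_\lambda,\dots\}$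 and for $f=\sum_{j=0}^mc_jK^{(j)}_\lambda$ with $c_m\ne0$ the degree of $f$ is $m$. For a nonzero $b\in\mathcal{H}^2_{\omega}$, $\mathcal{H}^2_{\omega}(|b|^2)$ is the completion of the holomorphic polynomials under the norm $\|f\|_{\mathcal{H}^2_{\omega}(|b|^2)}=\|fb\|_{\mathcal{H}^2_{\omega}}$ (inner product $\langle f,g\rangle_{\mathcal{H}^2_{\omega}(|b|^2)}=\langle fb,gb\rangle_{\mathcal{H}^2_{\omega}}$); it is a reproducing kernel Hilbert space of holomorphic functions on $\mathbb{D}$. A function $f$ is $\mathcal{H}^2_{\omega}$-inner if $\|f\|=1$ and $\langle z^mf,f\rangle=0$ for all integers $m\geq1$. *)

(* Defs.v *)
From Stdlib Require Import Reals List Arith Factorial.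
Open Scope R_scope.

Record Cx := mkC { Re : R; Im : R }.
Definition C0 : Cx := mkC 0 0.
Definition C1 : Cx := mkC 1 0.
Definition RtoC (x : R) : Cx := mkC x 0.
Definition Cadd (z w : Cx) : Cx := mkC (Re z + Re w) (Im z + Im w).
Definition Copp (z : Cx) : Cx := mkC (- Re z) (- Im z).
Definition Csub (z w : Cx) : Cx := Cadd z (Copp w).
Definition Cmul (z w : Cx) : Cx :=
  mkC (Re z * Re w - Im z * Im w) (Re z * Im w + Im z * Re w).
Definition Cconj (z : Cx) : Cx := mkC (Re z) (- Im z).
Definition Cnorm2 (z : Cx) : R := Re z * Re z + Im z * Im z.
Definition Cmod (z : Cx) : R := sqrt (Cnorm2 z).
Definition Cinv (z : Cx) : Cx := mkC (Re z / Cnorm2 z) (- Im z / Cnorm2 z).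
Definition Cdiv (z w : Cx) : Cx := Cmul z (Cinv w).
Fixpoint Cpow (z : Cx) (n : nat) : Cx :=
  match n with O => C1 | S k => Cmul z (Cpow z k) end.
Fixpoint Csum (f : nat -> Cx) (n : nat) : Cx :=
  match n with O => C0 | S k => Cadd (Csum f k) (f k) end.
Fixpoint Cprod (f : nat -> Cx) (n : nat) : Cx :=
  match n with O => C1 | S k => Cmul (Cprod f k) (f k) end.

Definition Csum_cv (u : nat -> Cx) (l : Cx) : Prop :=
  infinite_sum (fun n => Re (u n)) (Re l) /\ infinite_sum (fun n => Im (u n)) (Im l).

Definition inD (z : Cx) : Prop := Cmod z < 1.

Definition holomorphic_on_D (f : Cx -> Cx) : Prop :=
  forall z, inD z -> exists l : Cx, forall eps, eps > 0 -> exists delta, delta > 0 /\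
    forall w, inD w -> 0 < Cmod (Csub w z) < delta ->
      Cmod (Csub (Cdiv (Csub (f w) (f z)) (Csub w z)) l) < eps.

Fixpoint Peval (p : list Cx) (z : Cx) : Cx :=
  match p with nil => C0 | a :: q => Cadd a (Cmul z (Peval q z)) end.

Definition admissible_weight (om : nat -> R) : Prop :=
  (forall n, 0 < om n) /\ om 0%nat = 1 /\
  Un_cv (fun n => om (S n) / om n) 1.

Definition has_norm2 (om : nat -> R) (a : nat -> Cx) (v : R) : Prop :=
  infinite_sum (fun n => om n * Cnorm2 (a n)) v.

Definition inH2 (om : nat -> R) (a : nat -> Cx) : Prop := exists v, has_norm2 om a v.

Definition has_inner (om : nat -> R) (a b : nat -> Cx) (v : Cx) : Prop :=
  Csum_cv (fun n => Cmul (RtoC (om n)) (Cmul (a n) (Cconj (b n)))) v.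

Definition represents (a : nat -> Cx) (F : Cx -> Cx) : Prop :=
  forall z, inD z -> Csum_cv (fun n => Cmul (a n) (Cpow z n)) (F z).

Definition shiftc (m : nat) (a : nat -> Cx) (n : nat) : Cx :=
  if Nat.leb m n then a (n - m)%nat else C0.

Definition H2_inner (om : nat -> R) (a : nat -> Cx) : Prop :=
  has_norm2 om a 1 /\ forall m, (1 <= m)%nat -> has_inner om (shiftc m a) a C0.

(** Coefficient n of K^(l)_lambda(z) = d^l/d(conj lambda)^l sum_k conj(lambda)^k z^k / om_k,
    namely [n >= l] n!/(n-l)! conj(lambda)^(n-l) / om_n. *)
Definition kercoef (om : nat -> R) (lam : Cx) (l n : nat) : Cx :=
  if Nat.leb l n then
    Cmul (RtoC (INR (Factorial.fact n) / INR (Factorial.fact (n - l)) / om n)) (Cpow (Cconj lam) (n - l))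
  else C0.

Definition in_X_deg (om : nat -> R) (lam : Cx) (m : nat) (a : nat -> Cx) : Prop :=
  exists c : nat -> Cx, c m <> C0 /\
    forall n, a n = Csum (fun j => Cmul (c j) (kercoef om lam j n)) (S m).

(** [in_Hb om b f h] : f belongs to H^2_omega(|b|^2) (the completion of the polynomials
    under ||p|| = ||p b||, realised as functions on the disk), and h is the
    H^2_omega coefficient sequence of f b.  Concretely: there are polynomials p_k
    with p_k b -> f b in H^2_omega and p_k -> f pointwise on the disk. *)
Definition in_Hb (om : nat -> R) (b : Cx -> Cx) (f : Cx -> Cx) (h : nat -> Cx) : Prop :=
  inH2 om h /\ represents h (fun z => Cmul (f z) (b z)) /\
  exists (p : nat -> list Cx) (hp : nat -> nat -> Cx) (dist : nat -> R),
    (forall k, represents (hp k) (fun z => Cmul (Peval (p k) z) (b z))) /\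
    (forall k, has_norm2 om (fun n => Csub (hp k n) (h n)) (dist k)) /\
    Un_cv dist 0 /\
    (forall z, inD z -> forall eps, eps > 0 -> exists N, forall k, (N <= k)%nat ->
        Cmod (Csub (Peval (p k) z) (f z)) < eps).

(** [k] (with [hk] the coefficients of k b) is the reproducing kernel of
    H^2_omega(|b|^2) at the origin: <f, k> = <f b, k b>_{H^2_omega} = f(0). *)
Definition is_RK0_Hb (om : nat -> R) (b : Cx -> Cx) (k : Cx -> Cx) (hk : nat -> Cx) : Prop :=
  in_Hb om b k hk /\
  forall f hf, in_Hb om b f hf -> has_inner om hf hk (f C0).

Definition blaschke (d0 s : nat) (zs : nat -> Cx) (ms : nat -> nat) (z : Cx) : Cx :=
  Cmul (Cpow z d0)
    (Cprod (fun i => Cpow (Cdiv (Csub z (zs (S i)))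
                              (Csub C1 (Cmul (Cconj (zs (S i))) z))) (ms (S i))) s).

(* Main.v *)
From Stdlib Require Import Reals List Lra Lia Psatz FunctionalExtensionality Arith.
From Coquelicot Require Import Rbar Lim_seq Hierarchy Series.
Require Import Defs.
Open Scope R_scope.

(** Since <h, K_lambda^(l)> = h^(l)(lambda), the map h |-> <h, B> is a functional E(h) involving the
    derivatives of h at the z_j up to order m_j - 1 (up to order d_0 at the origin), with nonzero top
    coefficients.  The orthogonality of B to z^m B says that E(q z B) = 0 for every polynomial q; choosing
    q to vanish to all orders seen by E except one shows successively that z B vanishes to order m_j at
    z_j and to order d_0 + 1 at 0.  Multiplication by z - l and by 1/(1 - l^* z) is bounded on H^2_omega,
    and so is division by z - l on the functions that vanish at l (the weight has ratio tending to 1),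
    so B = g b with g in H^2_omega, and the truncations of g give polynomials p with p b -> B.  Finally
    E(u b) only sees the derivative of order d_0 at the origin, so <u b, B> = E(u b) = k u(0) with k
    nonzero, first for polynomials u and then, by continuity, on all of H^2_omega(|b|^2). *)

(** Functions are handled through their coefficient sequences, so that multiplication, division,
    derivatives and norms all become recursions on the index. The obstacle is the weight: it may
    tend to 0 or to infinity and need not be monotone, and only its consecutive ratios are
    controlled, and only from some index on. A recursion therefore contracts only eventually, with
    the room that |l| < 1 leaves for the error of the ratio, and finitely many initial steps are
    absorbed by a crude constant. Operators whose output up to N depends on the input up to N are
    bounded on partial sums, with no convergence needed; division by z - l uses the later
    coefficients, and its recursion runs backwards from infinity.

    The orders are what makes the result come out: a polynomial of degree d_0 is a combination of
    d_0 + 1 kernels at the origin, while b has a zero of order d_0 there. Passing from B to z B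
    costs exactly this one order in the vanishing argument, and the same surplus derivative is what
    survives in E(u b). *)

(** * Complex arithmetic and finite sums *)

Lemma Cx_eq (z w : Cx) : Re z = Re w -> Im z = Im w -> z = w.
Proof. destruct z, w; simpl; intros; subst; reflexivity. Qed.

Lemma Cnorm2_eq0 (z : Cx) : Cnorm2 z = 0 -> z = C0.
Proof. destruct z as [a b]; unfold Cnorm2; simpl; intros H; apply Cx_eq; simpl; nra. Qed.

Lemma Cnorm2_ge0 (z : Cx) : 0 <= Cnorm2 z.
Proof. unfold Cnorm2; nra. Qed.

Lemma Cx_field : field_theory C0 C1 Cadd Cmul Csub Copp Cdiv Cinv (@eq Cx).
Proof.
  constructor.
  - constructor; intros; apply Cx_eq; simpl; ring.
  - intros H; injection H; lra.
  - reflexivity.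
  - intros p Hp. assert (H : Cnorm2 p <> 0) by (intros H; apply Hp, Cnorm2_eq0, H).
    unfold Cnorm2 in H; apply Cx_eq; simpl; unfold Cnorm2; field; exact H.
Qed.

Add Field Cx_field_inst : Cx_field.

(** Needed by [count_occ], which reads the multiplicity of a point off a list of zeros. *)
Lemma Cx_eq_dec (z w : Cx) : {z = w} + {z <> w}.
Proof.
  destruct (Req_EM_T (Re z) (Re w)) as [H|H].
  - destruct (Req_EM_T (Im z) (Im w)) as [H'|H'].
    + left; apply Cx_eq; assumption.
    + right; intros E; apply H'; rewrite E; reflexivity.
  - right; intros E; apply H; rewrite E; reflexivity.
Defined.

Lemma Cmul_neq0 (z w : Cx) : z <> C0 -> w <> C0 -> Cmul z w <> C0.
Proof.
  intros Hz Hw H; apply Hw.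
  replace w with (Cmul (Cinv z) (Cmul z w)) by (field; exact Hz). rewrite H; ring.
Qed.

Lemma Csub_neq0 (z w : Cx) : z <> w -> Csub z w <> C0.
Proof.
  intros H E; apply H. replace z with (Cadd (Csub z w) w) by ring. rewrite E; ring.
Qed.

Lemma Cmul_cancel_l (z w : Cx) : z <> C0 -> Cmul z w = C0 -> w = C0.
Proof.
  intros Hz H. replace w with (Cmul (Cinv z) (Cmul z w)) by (field; exact Hz). rewrite H; ring.
Qed.

Lemma Cmod_ge0 (z : Cx) : 0 <= Cmod z.
Proof. apply sqrt_pos. Qed.

Lemma Cmod_sqr (z : Cx) : Cmod z * Cmod z = Cnorm2 z.
Proof. apply sqrt_sqrt, Cnorm2_ge0. Qed.

Lemma Cmod_add (z w : Cx) : Cmod (Cadd z w) <= Cmod z + Cmod w.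
Proof.
  pose proof (Cmod_ge0 z) as Hz; pose proof (Cmod_ge0 w) as Hw.
  pose proof (Cmod_sqr z) as Ez; pose proof (Cmod_sqr w) as Ew.
  apply Rsqr_incr_0; [|apply Cmod_ge0|lra].
  unfold Rsqr; rewrite Cmod_sqr.
  assert (H : Re z * Re w + Im z * Im w <= Cmod z * Cmod w).
  { apply Rsqr_incr_0_var; [|nra]. unfold Rsqr.
    replace (Cmod z * Cmod w * (Cmod z * Cmod w)) with ((Cmod z * Cmod z) * (Cmod w * Cmod w)) by ring.
    rewrite Ez, Ew; unfold Cnorm2. pose proof (Rle_0_sqr (Re z * Im w - Im z * Re w)) as Q.
    unfold Rsqr in Q; lra. }
  replace ((Cmod z + Cmod w) * (Cmod z + Cmod w))
    with (Cmod z * Cmod z + Cmod w * Cmod w + 2 * (Cmod z * Cmod w)) by ring.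
  rewrite Ez, Ew; unfold Cnorm2 in *; simpl; lra.
Qed.

Lemma Cmod_mul (z w : Cx) : Cmod (Cmul z w) = Cmod z * Cmod w.
Proof.
  unfold Cmod; rewrite <- sqrt_mult by apply Cnorm2_ge0. f_equal; unfold Cnorm2; simpl; ring.
Qed.

Lemma Cmod_opp (z : Cx) : Cmod (Copp z) = Cmod z.
Proof. unfold Cmod; f_equal; unfold Cnorm2; simpl; ring. Qed.

Lemma Cmod_conj (z : Cx) : Cmod (Cconj z) = Cmod z.
Proof. unfold Cmod; f_equal; unfold Cnorm2; simpl; ring. Qed.

Lemma Cmod_C0 : Cmod C0 = 0.
Proof. unfold Cmod, Cnorm2; simpl. replace (0 * 0 + 0 * 0) with 0 by ring. apply sqrt_0. Qed.

Lemma Cmod_C1 : Cmod C1 = 1.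
Proof. unfold Cmod, Cnorm2; simpl. replace (1 * 1 + 0 * 0) with 1 by ring. apply sqrt_1. Qed.

Lemma Cmod_eq0 (z : Cx) : Cmod z = 0 -> z = C0.
Proof. intros H; apply Cnorm2_eq0; rewrite <- Cmod_sqr, H; ring. Qed.

Lemma Cmod_RtoC (x : R) : 0 <= x -> Cmod (RtoC x) = x.
Proof.
  intros H; unfold Cmod, Cnorm2; simpl.
  replace (x * x + 0 * 0) with (x * x) by ring. apply sqrt_square, H.
Qed.

Lemma Cmod_pow (z : Cx) (n : nat) : Cmod (Cpow z n) = Cmod z ^ n.
Proof. induction n; simpl; [apply Cmod_C1|rewrite Cmod_mul, IHn; reflexivity]. Qed.

Lemma Re_le_Cmod (z : Cx) : Rabs (Re z) <= Cmod z.
Proof.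
  apply Rsqr_incr_0; [|apply Rabs_pos|apply Cmod_ge0].
  unfold Rsqr. rewrite Cmod_sqr. rewrite <- Rabs_mult, Rabs_pos_eq by nra. unfold Cnorm2; nra.
Qed.

Lemma Im_le_Cmod (z : Cx) : Rabs (Im z) <= Cmod z.
Proof.
  apply Rsqr_incr_0; [|apply Rabs_pos|apply Cmod_ge0].
  unfold Rsqr. rewrite Cmod_sqr. rewrite <- Rabs_mult, Rabs_pos_eq by nra. unfold Cnorm2; nra.
Qed.

Lemma Cmod_le_Re_Im (z : Cx) : Cmod z <= Rabs (Re z) + Rabs (Im z).
Proof.
  apply Rsqr_incr_0; [|apply Cmod_ge0|].
  - unfold Rsqr; rewrite Cmod_sqr; unfold Cnorm2.
    pose proof (Rabs_pos (Re z)); pose proof (Rabs_pos (Im z)).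
    assert (Rabs (Re z) * Rabs (Re z) = Re z * Re z) by (rewrite <- Rabs_mult, Rabs_pos_eq; nra).
    assert (Rabs (Im z) * Rabs (Im z) = Im z * Im z) by (rewrite <- Rabs_mult, Rabs_pos_eq; nra).
    nra.
  - pose proof (Rabs_pos (Re z)); pose proof (Rabs_pos (Im z)); lra.
Qed.

Lemma Cconj_add (z w : Cx) : Cconj (Cadd z w) = Cadd (Cconj z) (Cconj w).
Proof. apply Cx_eq; simpl; ring. Qed.

Lemma Cconj_mul (z w : Cx) : Cconj (Cmul z w) = Cmul (Cconj z) (Cconj w).
Proof. apply Cx_eq; simpl; ring. Qed.

Lemma Cconj_conj (z : Cx) : Cconj (Cconj z) = z.
Proof. apply Cx_eq; simpl; ring. Qed.

Lemma Cconj_RtoC (x : R) : Cconj (RtoC x) = RtoC x.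
Proof. apply Cx_eq; simpl; ring. Qed.

Lemma Cconj_pow (z : Cx) (n : nat) : Cconj (Cpow z n) = Cpow (Cconj z) n.
Proof.
  induction n; simpl; [apply Cx_eq; simpl; ring|rewrite Cconj_mul, IHn; reflexivity].
Qed.

Lemma Cconj_neq0 (z : Cx) : z <> C0 -> Cconj z <> C0.
Proof.
  intros H E; apply H. rewrite <- (Cconj_conj z), E. apply Cx_eq; simpl; ring.
Qed.

Lemma RtoC_mul (x y : R) : RtoC (x * y) = Cmul (RtoC x) (RtoC y).
Proof. apply Cx_eq; simpl; ring. Qed.

Lemma RtoC_neq0 (x : R) : x <> 0 -> RtoC x <> C0.
Proof. intros H E; apply H; injection E; auto. Qed.

Lemma inD_C0 : inD C0.
Proof. unfold inD; rewrite Cmod_C0; lra. Qed.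

(** Written as a + b z, the shape in which [mul_lin] produces the factor 1 - l^* z. *)
Lemma Blaschke_denominator_neq0 (l z : Cx) : inD l -> inD z ->
  Cadd C1 (Cmul (Copp (Cconj l)) z) <> C0.
Proof.
  unfold inD; intros Hl Hz E.
  assert (H : Cmul (Cconj l) z = C1).
  { replace (Cmul (Cconj l) z) with (Csub C1 (Cadd C1 (Cmul (Copp (Cconj l)) z))) by ring.
    rewrite E; ring. }
  apply (f_equal Cmod) in H. rewrite Cmod_mul, Cmod_conj, Cmod_C1 in H.
  pose proof (Cmod_ge0 l); pose proof (Cmod_ge0 z); nra.
Qed.

Lemma Csum_ext (f g : nat -> Cx) (n : nat) :
  (forall i, (i < n)%nat -> f i = g i) -> Csum f n = Csum g n.
Proof.
  induction n; simpl; intros H; [reflexivity|]. rewrite IHn, H; auto.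
Qed.

Lemma Csum_eq0 (f : nat -> Cx) (n : nat) :
  (forall i, (i < n)%nat -> f i = C0) -> Csum f n = C0.
Proof.
  induction n; simpl; intros H; [reflexivity|]. rewrite IHn, H; auto; ring.
Qed.

Lemma Csum_only (f : nat -> Cx) (n i : nat) : (i < n)%nat ->
  (forall j, (j < n)%nat -> j <> i -> f j = C0) -> Csum f n = f i.
Proof.
  induction n; simpl; intros Hi H; [lia|].
  destruct (Nat.eq_dec i n) as [->|Hne].
  - rewrite Csum_eq0; [ring|]. intros j Hj; apply H; lia.
  - rewrite IHn; [|lia|intros; apply H; lia]. rewrite (H n); [ring|lia|lia].
Qed.

Lemma Csum_add (f g : nat -> Cx) (n : nat) :
  Csum (fun i => Cadd (f i) (g i)) n = Cadd (Csum f n) (Csum g n).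
Proof. induction n; simpl; [ring|rewrite IHn; ring]. Qed.

Lemma Csum_scal (c : Cx) (f : nat -> Cx) (n : nat) :
  Csum (fun i => Cmul c (f i)) n = Cmul c (Csum f n).
Proof. induction n; simpl; [ring|rewrite IHn; ring]. Qed.

Lemma Csum_conj (f : nat -> Cx) (n : nat) :
  Cconj (Csum f n) = Csum (fun i => Cconj (f i)) n.
Proof. induction n; simpl; [apply Cx_eq; simpl; ring|rewrite Cconj_add, IHn; reflexivity]. Qed.

Lemma Csum_recl (f : nat -> Cx) (n : nat) :
  Csum f (S n) = Cadd (f 0%nat) (Csum (fun i => f (S i)) n).
Proof.
  induction n; [simpl; ring|]. change (Csum f (S (S n))) with (Cadd (Csum f (S n)) (f (S n))).
  rewrite IHn; simpl; ring.
Qed.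

(** * Convergent complex series *)

Lemma Csum_cv_unique (u : nat -> Cx) (l l' : Cx) : Csum_cv u l -> Csum_cv u l' -> l = l'.
Proof. intros [a b] [c d]; apply Cx_eq; eapply uniqueness_sum; eassumption. Qed.

Lemma Csum_cv_ext (u v : nat -> Cx) (l : Cx) :
  (forall n, u n = v n) -> Csum_cv u l -> Csum_cv v l.
Proof. intros H; replace v with u; [auto|apply functional_extensionality, H]. Qed.

Lemma infinite_sum_lin (a b : R) (u v : nat -> R) (l m : R) :
  infinite_sum u l -> infinite_sum v m ->
  infinite_sum (fun n => a * u n + b * v n) (a * l + b * m).
Proof.
  intros Hu Hv; apply is_series_Reals. apply is_series_Reals in Hu, Hv.
  apply (is_series_plus (fun n => a * u n) (fun n => b * v n)).
  - apply (is_series_scal a u l Hu).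
  - apply (is_series_scal b v m Hv).
Qed.

Lemma infinite_sum_decr (u : nat -> R) (l : R) :
  infinite_sum (fun n => u (S n)) l -> infinite_sum u (u 0%nat + l).
Proof.
  intros H; apply is_series_Reals; apply is_series_Reals in H.
  apply is_series_decr_1.
  match goal with |- is_series _ ?x => replace x with l; [exact H|] end.
  change (l = u 0%nat + l + - u 0%nat); ring.
Qed.

Lemma Csum_cv_add (u v : nat -> Cx) (l m : Cx) : Csum_cv u l -> Csum_cv v m ->
  Csum_cv (fun n => Cadd (u n) (v n)) (Cadd l m).
Proof.
  intros [a b] [c d]; split; simpl.
  - replace (Re l + Re m) with (1 * Re l + 1 * Re m) by ring.
    replace (fun n => Re (u n) + Re (v n)) with (fun n => 1 * Re (u n) + 1 * Re (v n))
      by (apply functional_extensionality; intros; ring).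
    apply infinite_sum_lin; assumption.
  - replace (Im l + Im m) with (1 * Im l + 1 * Im m) by ring.
    replace (fun n => Im (u n) + Im (v n)) with (fun n => 1 * Im (u n) + 1 * Im (v n))
      by (apply functional_extensionality; intros; ring).
    apply infinite_sum_lin; assumption.
Qed.

Lemma Csum_cv_scal (c : Cx) (u : nat -> Cx) (l : Cx) : Csum_cv u l ->
  Csum_cv (fun n => Cmul c (u n)) (Cmul c l).
Proof.
  intros [a b]; split; simpl.
  - replace (Re c * Re l - Im c * Im l) with (Re c * Re l + - Im c * Im l) by ring.
    replace (fun n => Re c * Re (u n) - Im c * Im (u n))
      with (fun n => Re c * Re (u n) + - Im c * Im (u n))
      by (apply functional_extensionality; intros; ring).
    apply infinite_sum_lin; assumption.
  - apply infinite_sum_lin; assumption.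
Qed.

Lemma Csum_cv_decr (u : nat -> Cx) (l : Cx) :
  Csum_cv (fun n => u (S n)) l -> Csum_cv u (Cadd (u 0%nat) l).
Proof.
  intros [a b]; split; simpl.
  - apply (infinite_sum_decr (fun n => Re (u n))); exact a.
  - apply (infinite_sum_decr (fun n => Im (u n))); exact b.
Qed.

Lemma Csum_cv_zeros (k : nat) (u : nat -> Cx) (l : Cx) :
  (forall n, (n < k)%nat -> u n = C0) -> Csum_cv (fun n => u (n + k)%nat) l -> Csum_cv u l.
Proof.
  revert u; induction k; intros u H0 H.
  - revert H; apply Csum_cv_ext; intros n; f_equal; lia.
  - replace l with (Cadd (u 0%nat) l) by (rewrite H0 by lia; ring).
    apply Csum_cv_decr, IHk.
    + intros n Hn; apply H0; lia.
    + revert H; apply Csum_cv_ext; intros n; f_equal; lia.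
Qed.

Lemma Csum_cv_0 : Csum_cv (fun _ => C0) C0.
Proof.
  split; simpl; intros eps He; exists 0%nat; intros n _;
    rewrite sum_cte; unfold Rdist; rewrite Rmult_0_l, Rminus_0_r, Rabs_R0; exact He.
Qed.

Lemma Csum_cv_Csum (u : nat -> nat -> Cx) (l : nat -> Cx) (k : nat) :
  (forall i, (i < k)%nat -> Csum_cv (u i) (l i)) ->
  Csum_cv (fun n => Csum (fun i => u i n) k) (Csum l k).
Proof.
  induction k; intros H; simpl; [apply Csum_cv_0|].
  apply (Csum_cv_add (fun n => Csum (fun i => u i n) k)); [apply IHk; auto|apply H; lia].
Qed.

Lemma infinite_sum_bound (u : nat -> R) (l M : R) (v : nat -> R) (m : R) :
  (forall n, Rabs (u n) <= v n) -> infinite_sum u l -> infinite_sum v m -> m <= M -> Rabs l <= M.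
Proof.
  intros H Hu Hv HM. apply Rle_trans with m; [|exact HM].
  apply is_series_Reals in Hu, Hv.
  rewrite <- (is_series_unique _ _ Hu), <- (is_series_unique _ _ Hv).
  assert (E : ex_series (fun n => Rabs (u n))).
  { apply (ex_series_le (fun n => Rabs (u n)) v); [|exists m; exact Hv].
    intros n. change (Rabs (Rabs (u n)) <= v n). rewrite Rabs_Rabsolu; apply H. }
  apply Rle_trans with (Series (fun n => Rabs (u n))); [apply Series_Rabs, E|].
  apply Series_le; [|exists m; exact Hv].
  intros n; split; [apply Rabs_pos|apply H].
Qed.

(** * Power series converging on the disk *)

(** The factor 2 comes from bounding the real and the imaginary part separately. *)
Lemma Csum_cv_dominated (u : nat -> Cx) (M q : R) : 0 <= q < 1 ->
  (forall n, Cmod (u n) <= M * q ^ n) ->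
  exists l, Csum_cv u l /\ Cmod l <= 2 * (M / (1 - q)).
Proof.
  intros Hq H.
  assert (G : is_series (fun n => M * q ^ n) (M / (1 - q))).
  { apply (is_series_scal M (fun n => q ^ n) (/ (1 - q))).
    apply is_series_geom. rewrite Rabs_pos_eq; lra. }
  assert (E : forall v : nat -> R, (forall n, Rabs (v n) <= Cmod (u n)) ->
            exists l, infinite_sum v l /\ Rabs l <= M / (1 - q)).
  { intros v Hv.
    assert (Ev : ex_series v).
    { apply (ex_series_le v (fun n => M * q ^ n)); [|eexists; exact G].
      intros n; apply Rle_trans with (Cmod (u n)); [apply Hv|apply H]. }
    destruct Ev as [l Hl]; exists l; apply is_series_Reals in Hl; split; [exact Hl|].
    apply (infinite_sum_bound v l _ (fun n => M * q ^ n) (M / (1 - q))).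
    - intros n; apply Rle_trans with (Cmod (u n)); [apply Hv|apply H].
    - exact Hl.
    - apply is_series_Reals; exact G.
    - apply Rle_refl. }
  destruct (E (fun n => Re (u n))) as [x [Hx Bx]]; [intros; apply Re_le_Cmod|].
  destruct (E (fun n => Im (u n))) as [y [Hy By]]; [intros; apply Im_le_Cmod|].
  exists (mkC x y); split; [split; assumption|].
  pose proof (Cmod_le_Re_Im (mkC x y)); simpl in *; lra.
Qed.

(** Radius of convergence at least 1, in a form that is easily carried through every operation
    below. *)
Definition disk_coefs (u : nat -> Cx) : Prop :=
  forall r, 0 < r < 1 -> exists M, forall n, Cmod (u n) * r ^ n <= M.

(** A total function: [Series] returns some value even without convergence, so [ev] is meaningful
    only together with [disk_coefs u] and [inD z]. *)
Definition ev (u : nat -> Cx) (z : Cx) : Cx :=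
  mkC (Series (fun n => Re (Cmul (u n) (Cpow z n)))) (Series (fun n => Im (Cmul (u n) (Cpow z n)))).

Lemma ev_unique (u : nat -> Cx) (z l : Cx) :
  Csum_cv (fun n => Cmul (u n) (Cpow z n)) l -> ev u z = l.
Proof.
  intros [a b]; apply is_series_Reals in a; apply is_series_Reals in b.
  apply Cx_eq; simpl; apply is_series_unique; assumption.
Qed.

Lemma Rpow_ratio (a r : R) (n : nat) : 0 < r -> a ^ n = r ^ n * (a / r) ^ n.
Proof. intros H; rewrite <- Rpow_mult_distr; f_equal; field; lra. Qed.

Lemma ev_bound (u : nat -> Cx) (rho r M : R) (z : Cx) :
  0 <= rho < r -> (forall n, Cmod (u n) * r ^ n <= M) -> Cmod z <= rho ->
  Csum_cv (fun n => Cmul (u n) (Cpow z n)) (ev u z) /\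
  Cmod (ev u z) <= 2 * (M / (1 - rho / r)).
Proof.
  intros Hr HM Hz.
  assert (Hq : 0 <= rho / r < 1).
  { split; [apply Rle_mult_inv_pos; lra|]. apply Rmult_lt_reg_r with r; [lra|].
    unfold Rdiv; rewrite Rmult_assoc, Rinv_l; lra. }
  destruct (Csum_cv_dominated (fun n => Cmul (u n) (Cpow z n)) M (rho / r) Hq) as [l [Hl Bl]].
  - intros n; rewrite Cmod_mul, Cmod_pow.
    apply Rle_trans with (Cmod (u n) * rho ^ n).
    + apply Rmult_le_compat_l; [apply Cmod_ge0|]. apply pow_incr; split; [apply Cmod_ge0|exact Hz].
    + rewrite (Rpow_ratio rho r n) by lra. rewrite <- Rmult_assoc.
      apply Rmult_le_compat_r; [apply pow_le; lra|apply HM].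
  - rewrite (ev_unique _ _ _ Hl); split; assumption.
Qed.

Lemma ev_cv (u : nat -> Cx) (z : Cx) : disk_coefs u -> inD z ->
  Csum_cv (fun n => Cmul (u n) (Cpow z n)) (ev u z).
Proof.
  intros Hu Hz; unfold inD in Hz; pose proof (Cmod_ge0 z).
  destruct (Hu ((1 + Cmod z) / 2)) as [M HM]; [lra|].
  apply (ev_bound u (Cmod z) ((1 + Cmod z) / 2) M); [lra|exact HM|lra].
Qed.

Lemma pow_le_1 (r : R) (n : nat) : 0 <= r <= 1 -> r ^ n <= 1.
Proof. intros H; rewrite <- (pow1 n); apply pow_incr; exact H. Qed.

(** The bound at a radius implies it at every smaller one. This serves [quo l], where the estimate
    needs a radius above |l|. *)
Lemma disk_coefs_near_1 (u : nat -> Cx) (r0 : R) : r0 < 1 ->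
  (forall r, 0 < r -> r0 < r < 1 -> exists M, forall n, Cmod (u n) * r ^ n <= M) -> disk_coefs u.
Proof.
  intros H0 H r Hr.
  pose proof (Rmax_l r ((1 + r0) / 2)); pose proof (Rmax_r r ((1 + r0) / 2)).
  destruct (H (Rmax r ((1 + r0) / 2))) as [M HM].
  - lra.
  - split; [lra|apply Rmax_lub_lt; lra].
  - exists M; intros n; eapply Rle_trans; [|apply HM].
    apply Rmult_le_compat_l; [apply Cmod_ge0|apply pow_incr; lra].
Qed.

(** * Operations on coefficient sequences *)

Definition add_seq (u v : nat -> Cx) (n : nat) : Cx := Cadd (u n) (v n).
Definition scal_seq (c : Cx) (u : nat -> Cx) (n : nat) : Cx := Cmul c (u n).
Definition sub_seq (u v : nat -> Cx) (n : nat) : Cx := Csub (u n) (v n).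
Definition shift (u : nat -> Cx) (n : nat) : Cx := match n with O => C0 | S k => u k end.
Definition drop_seq (m : nat) (u : nat -> Cx) (n : nat) : Cx := u (m + n)%nat.
Definition der (u : nat -> Cx) (n : nat) : Cx := Cmul (RtoC (INR (S n))) (u (S n)).
Fixpoint dern (l : nat) (u : nat -> Cx) : nat -> Cx :=
  match l with O => u | S k => der (dern k u) end.

(* [mul_lin a b u] and [div_lin m u] are the coefficients of (a + b z) u(z) and u(z) / (1 - m z). *)
Definition mul_lin (a b : Cx) (u : nat -> Cx) (n : nat) : Cx := Cadd (Cmul a (u n)) (Cmul b (shift u n)).
Fixpoint div_lin (m : Cx) (u : nat -> Cx) (n : nat) : Cx :=
  match n with O => u O | S k => Cadd (u (S k)) (Cmul m (div_lin m u k)) end.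

Lemma disk_coefs_add (u v : nat -> Cx) : disk_coefs u -> disk_coefs v -> disk_coefs (add_seq u v).
Proof.
  intros Hu Hv r Hr; destruct (Hu r Hr) as [M HM]; destruct (Hv r Hr) as [N HN].
  exists (M + N); intros n. specialize (HM n); specialize (HN n).
  pose proof (Cmod_add (u n) (v n)). assert (0 <= r ^ n) by (apply pow_le; lra).
  unfold add_seq; nra.
Qed.

Lemma disk_coefs_scal (c : Cx) (u : nat -> Cx) : disk_coefs u -> disk_coefs (scal_seq c u).
Proof.
  intros Hu r Hr; destruct (Hu r Hr) as [M HM]. exists (Cmod c * M); intros n.
  unfold scal_seq; rewrite Cmod_mul, Rmult_assoc.
  apply Rmult_le_compat_l; [apply Cmod_ge0|apply HM].
Qed.

Lemma sub_seqE (u v : nat -> Cx) : sub_seq u v = add_seq u (scal_seq (Copp C1) v).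
Proof. apply functional_extensionality; intros n; unfold sub_seq, add_seq, scal_seq; ring. Qed.

Lemma disk_coefs_sub (u v : nat -> Cx) : disk_coefs u -> disk_coefs v -> disk_coefs (sub_seq u v).
Proof. intros; rewrite sub_seqE; apply disk_coefs_add; [|apply disk_coefs_scal]; assumption. Qed.

Lemma disk_coefs_shift (u : nat -> Cx) : disk_coefs u -> disk_coefs (shift u).
Proof.
  intros Hu r Hr; destruct (Hu r Hr) as [M HM]. exists M.
  assert (HM0 : 0 <= M).
  { apply Rle_trans with (Cmod (u 0%nat) * r ^ 0); [|apply HM]. simpl.
    pose proof (Cmod_ge0 (u 0%nat)); lra. }
  intros [|n]; simpl; [rewrite Cmod_C0; lra|].
  specialize (HM n). assert (0 <= Cmod (u n) * r ^ n) by
    (apply Rmult_le_pos; [apply Cmod_ge0|apply pow_le; lra]).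
  nra.
Qed.

Lemma mul_linE (a b : Cx) (u : nat -> Cx) :
  mul_lin a b u = add_seq (scal_seq a u) (scal_seq b (shift u)).
Proof. reflexivity. Qed.

Lemma disk_coefs_mul_lin (a b : Cx) (u : nat -> Cx) : disk_coefs u -> disk_coefs (mul_lin a b u).
Proof.
  intros H; rewrite mul_linE; apply disk_coefs_add; apply disk_coefs_scal; [exact H|].
  apply disk_coefs_shift, H.
Qed.

Lemma disk_coefs_drop (m : nat) (u : nat -> Cx) : disk_coefs u -> disk_coefs (drop_seq m u).
Proof.
  intros Hu r Hr; destruct (Hu r Hr) as [M HM]. exists (M / r ^ m); intros n.
  assert (0 < r ^ m) by (apply pow_lt; lra).
  apply Rmult_le_reg_r with (r ^ m); [assumption|].
  replace (M / r ^ m * r ^ m) with M by (field; lra).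
  rewrite Rmult_assoc, <- pow_add, Nat.add_comm; apply HM.
Qed.

(** The power q^n is the least of the n + 1 terms of the geometric sum 1 + q + ... + q^n. This
    absorbs the factor n + 1 of a derivative. *)
Lemma linear_times_geometric (q : R) (n : nat) : 0 <= q <= 1 ->
  INR (S n) * q ^ n * (1 - q) <= 1 - q ^ S n.
Proof.
  intros Hq; induction n; [simpl; lra|].
  assert (0 <= q ^ S n <= 1) by (split; [apply pow_le|apply pow_le_1]; lra).
  rewrite S_INR. simpl (q ^ S (S n)). simpl (q ^ S n) in *. nra.
Qed.

Lemma disk_coefs_der (u : nat -> Cx) : disk_coefs u -> disk_coefs (der u).
Proof.
  (* The coefficients are bounded at the larger radius t; the spare factor (r/t)^n then beats n +
     1. *)
  intros Hu r Hr. set (t := (1 + r) / 2).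
  destruct (disk_coefs_drop 1 u Hu t) as [M HM]; [unfold t; lra|].
  assert (Ht : r < t < 1) by (unfold t; lra).
  assert (Hq : 0 <= r / t < 1).
  { split; [apply Rle_mult_inv_pos; lra|]. apply Rmult_lt_reg_r with t; [lra|].
    unfold Rdiv; rewrite Rmult_assoc, Rinv_l; lra. }
  exists (M / (1 - r / t)); intros n.
  apply Rmult_le_reg_r with (1 - r / t); [lra|].
  replace (M / (1 - r / t) * (1 - r / t)) with M by (field; lra).
  unfold der; rewrite Cmod_mul, Cmod_RtoC by apply pos_INR.
  rewrite (Rpow_ratio r t n) by lra.
  specialize (HM n); unfold drop_seq in HM; simpl (1 + n)%nat in HM.
  pose proof (linear_times_geometric (r / t) n) as L.
  assert (0 <= (r / t) ^ S n) by (apply pow_le; lra).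
  set (x := Cmod (u (S n)) * t ^ n) in *.
  set (y := INR (S n) * (r / t) ^ n * (1 - r / t)) in *.
  replace (INR (S n) * Cmod (u (S n)) * (t ^ n * (r / t) ^ n) * (1 - r / t)) with (x * y)
    by (unfold x, y; ring).
  assert (0 <= x) by (apply Rmult_le_pos; [apply Cmod_ge0|apply pow_le; lra]).
  assert (y <= 1) by lra. nra.
Qed.

Lemma disk_coefs_dern (l : nat) (u : nat -> Cx) : disk_coefs u -> disk_coefs (dern l u).
Proof. intros H; induction l; simpl; [exact H|apply disk_coefs_der, IHl]. Qed.

Lemma disk_coefs_div_lin (m : Cx) (u : nat -> Cx) : inD m -> disk_coefs u -> disk_coefs (div_lin m u).
Proof.
  intros Hm Hu r Hr; destruct (Hu r Hr) as [M HM]. exists (M / (1 - r)); intros n.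
  unfold inD in Hm; pose proof (Cmod_ge0 m).
  apply Rmult_le_reg_r with (1 - r); [lra|].
  replace (M / (1 - r) * (1 - r)) with M by (field; lra).
  (* With x_n = |div_lin m u n| r^n the recursion reads x_{n+1} <= M + r x_n, and M / (1 - r) is its
     fixed point. *)
  induction n.
  - specialize (HM 0%nat); simpl in *. pose proof (Cmod_ge0 (u 0%nat)); nra.
  - specialize (HM (S n)). simpl div_lin.
    pose proof (Cmod_add (u (S n)) (Cmul m (div_lin m u n))) as T. rewrite Cmod_mul in T.
    assert (0 <= r ^ n) by (apply pow_le; lra). simpl (r ^ S n) in *.
    set (c := Cmod (div_lin m u n)) in *. assert (Hc : 0 <= c) by apply Cmod_ge0.
    assert (Cmod m * c <= c) by nra.
    assert (Cmod (Cadd (u (S n)) (Cmul m (div_lin m u n))) * (r * r ^ n) <= M + r * (c * r ^ n)).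
    { apply Rle_trans with ((Cmod (u (S n)) + c) * (r * r ^ n)); [|nra].
      apply Rmult_le_compat_r; [nra|lra]. }
    nra.
Qed.

Lemma ev_add (u v : nat -> Cx) (z : Cx) : disk_coefs u -> disk_coefs v -> inD z ->
  ev (add_seq u v) z = Cadd (ev u z) (ev v z).
Proof.
  intros Hu Hv Hz; apply ev_unique.
  apply (Csum_cv_ext (fun n => Cadd (Cmul (u n) (Cpow z n)) (Cmul (v n) (Cpow z n)))).
  - intros n; unfold add_seq; ring.
  - apply Csum_cv_add; apply ev_cv; assumption.
Qed.

Lemma ev_scal (c : Cx) (u : nat -> Cx) (z : Cx) : disk_coefs u -> inD z ->
  ev (scal_seq c u) z = Cmul c (ev u z).
Proof.
  intros Hu Hz; apply ev_unique.
  apply (Csum_cv_ext (fun n => Cmul c (Cmul (u n) (Cpow z n)))).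
  - intros n; unfold scal_seq; ring.
  - apply Csum_cv_scal, ev_cv; assumption.
Qed.

(** A Horner step on the tails of the series. It yields both the factorisation by z - l and the
    backward recursion for the coefficients of the quotient. *)
Lemma ev_drop (m : nat) (u : nat -> Cx) (z : Cx) : disk_coefs u -> inD z ->
  ev (drop_seq m u) z = Cadd (u m) (Cmul z (ev (drop_seq (S m) u) z)).
Proof.
  intros Hu Hz; apply ev_unique.
  assert (E : u m = Cmul (drop_seq m u 0) (Cpow z 0)).
  { unfold drop_seq; rewrite Nat.add_0_r; simpl; ring. }
  rewrite E. apply (Csum_cv_decr (fun n => Cmul (drop_seq m u n) (Cpow z n))).
  apply (Csum_cv_ext (fun n => Cmul z (Cmul (drop_seq (S m) u n) (Cpow z n)))).
  - intros n; unfold drop_seq; replace (m + S n)%nat with (S m + n)%nat by lia; simpl; ring.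
  - apply Csum_cv_scal, ev_cv; [apply disk_coefs_drop|]; assumption.
Qed.

Lemma ev_shift (u : nat -> Cx) (z : Cx) : disk_coefs u -> inD z ->
  ev (shift u) z = Cmul z (ev u z).
Proof.
  intros Hu Hz. change (shift u) with (drop_seq 0 (shift u)).
  rewrite ev_drop by (try apply disk_coefs_shift; assumption). simpl.
  change (drop_seq 1 (shift u)) with u. ring.
Qed.

Lemma ev_mul_lin (a b : Cx) (u : nat -> Cx) (z : Cx) : disk_coefs u -> inD z ->
  ev (mul_lin a b u) z = Cmul (Cadd a (Cmul b z)) (ev u z).
Proof.
  intros Hu Hz; rewrite mul_linE, ev_add, !ev_scal, ev_shift; try assumption.
  - ring.
  - apply disk_coefs_shift, Hu.
  - apply disk_coefs_scal, Hu.
  - apply disk_coefs_scal, disk_coefs_shift, Hu.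
Qed.

Lemma mul_lin_div_lin (m : Cx) (u : nat -> Cx) : mul_lin C1 (Copp m) (div_lin m u) = u.
Proof.
  apply functional_extensionality; intros [|n]; unfold mul_lin; simpl; ring.
Qed.

Lemma div_lin_mul_lin (m : Cx) (u : nat -> Cx) : div_lin m (mul_lin C1 (Copp m) u) = u.
Proof.
  apply functional_extensionality; intros n; induction n; simpl.
  - unfold mul_lin; simpl; ring.
  - rewrite IHn; unfold mul_lin; simpl; ring.
Qed.

Lemma ev_div_lin (l : Cx) (u : nat -> Cx) (z : Cx) : disk_coefs u -> inD l -> inD z ->
  ev (div_lin (Cconj l) u) z = Cdiv (ev u z) (Cadd C1 (Cmul (Copp (Cconj l)) z)).
Proof.
  intros Hu Hl Hz. pose proof (Blaschke_denominator_neq0 l z Hl Hz) as H.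
  assert (D : disk_coefs (div_lin (Cconj l) u)).
  { apply disk_coefs_div_lin; [|exact Hu]. unfold inD; rewrite Cmod_conj; exact Hl. }
  rewrite <- (mul_lin_div_lin (Cconj l) u) at 2. rewrite ev_mul_lin by assumption.
  field; exact H.
Qed.

(* Coefficients of (u(z) - u(l)) / (z - l). *)
Definition quo (l : Cx) (u : nat -> Cx) (n : nat) : Cx := ev (drop_seq (S n) u) l.

Lemma disk_coefs_quo (l : Cx) (u : nat -> Cx) : inD l -> disk_coefs u -> disk_coefs (quo l u).
Proof.
  intros Hl Hu; unfold inD in Hl; pose proof (Cmod_ge0 l).
  apply (disk_coefs_near_1 _ (Cmod l)); [exact Hl|].
  intros r Hr0 Hr; destruct (Hu r) as [M HM]; [lra|].
  exists (2 * (M / (1 - Cmod l / r)) / r); intros n.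
  assert (0 < r ^ S n) by (apply pow_lt; lra).
  (* The tail starting at n + 1 inherits the bound M / r^(n+1) and is summed at |l| < r. *)
  assert (B : Cmod (quo l u n) <= 2 * (M / r ^ S n / (1 - Cmod l / r))).
  { apply (ev_bound (drop_seq (S n) u) (Cmod l) r); [lra| |lra].
    intros k; apply Rmult_le_reg_r with (r ^ S n); [assumption|].
    replace (M / r ^ S n * r ^ S n) with M by (field; lra).
    rewrite Rmult_assoc, <- pow_add, Nat.add_comm; apply HM. }
  assert (Hq : Cmod l / r < 1).
  { apply Rmult_lt_reg_r with r; [lra|]. unfold Rdiv; rewrite Rmult_assoc, Rinv_l; lra. }
  apply Rle_trans with (2 * (M / r ^ S n / (1 - Cmod l / r)) * r ^ n).
  - apply Rmult_le_compat_r; [apply pow_le; lra|exact B].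
  - apply Req_le. simpl. simpl in *. assert (0 < r ^ n) by (apply pow_lt; lra).
    field. repeat split; try lra.
Qed.

Lemma mul_lin_quo (l : Cx) (u : nat -> Cx) : inD l -> disk_coefs u -> ev u l = C0 ->
  mul_lin (Copp l) C1 (quo l u) = u.
Proof.
  intros Hl Hu H0; apply functional_extensionality; intros [|n]; unfold mul_lin, quo; simpl.
  (* Only the constant coefficient uses the zero at [l]; the other coefficients agree for every
     [u]. *)
  - pose proof (ev_drop 0 u l Hu Hl) as E. change (drop_seq 0 u) with u in E. rewrite H0 in E.
    replace (u 0%nat)
      with (Csub (Cadd (u 0%nat) (Cmul l (ev (drop_seq 1 u) l))) (Cmul l (ev (drop_seq 1 u) l)))
      by ring.
    rewrite <- E; ring.
  - rewrite (ev_drop (S n) u l) by assumption. ring.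
Qed.

(** The factorisation [mul_lin_quo] is applied to u - u(z), which vanishes at z; [quo z] never reads
    the constant coefficient, so the subtracted constant disappears from it. *)
Lemma ev_increment (u : nat -> Cx) (z w : Cx) : disk_coefs u -> inD z -> inD w ->
  Csub (ev u w) (ev u z) = Cmul (Csub w z) (ev (quo z u) w).
Proof.
  intros Hu Hz Hw.
  set (cst := fun n : nat => match n with O => ev u z | S _ => C0 end).
  assert (Ec : forall x, Csum_cv (fun n => Cmul (cst n) (Cpow x n)) (ev u z)).
  { intros x. replace (ev u z) with (Cadd (Cmul (cst 0%nat) (Cpow x 0)) C0) by (simpl; ring).
    apply (Csum_cv_decr (fun n => Cmul (cst n) (Cpow x n))).
    apply (Csum_cv_ext (fun _ => C0)); [intros; simpl; ring|apply Csum_cv_0]. }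
  assert (Dc : disk_coefs cst).
  { intros r Hr; exists (Cmod (ev u z)); intros [|n]; simpl; [lra|].
    rewrite Cmod_C0; pose proof (Cmod_ge0 (ev u z)); lra. }
  assert (Dv : disk_coefs (sub_seq u cst)) by (apply disk_coefs_sub; assumption).
  assert (Ev : forall x, inD x -> ev (sub_seq u cst) x = Csub (ev u x) (ev u z)).
  { intros x Hx; rewrite sub_seqE, ev_add, ev_scal; try assumption; [|apply disk_coefs_scal, Dc].
    rewrite (ev_unique _ _ _ (Ec x)); ring. }
  rewrite <- Ev by assumption.
  rewrite <- (mul_lin_quo z (sub_seq u cst)); try assumption; [|rewrite Ev by assumption; ring].
  rewrite ev_mul_lin by (try apply disk_coefs_quo; assumption).
  replace (quo z (sub_seq u cst)) with (quo z u); [ring|].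
  apply functional_extensionality; intros n; unfold quo; f_equal.
  apply functional_extensionality; intros k; unfold drop_seq, sub_seq; simpl; ring.
Qed.

Lemma ev_continuous (u : nat -> Cx) (z : Cx) : disk_coefs u -> inD z ->
  forall eps, eps > 0 -> exists delta, delta > 0 /\
    forall w, inD w -> Cmod (Csub w z) < delta -> Cmod (Csub (ev u w) (ev u z)) < eps.
Proof.
  intros Hu Hz eps He. pose proof Hz as Hz'; unfold inD in Hz'; pose proof (Cmod_ge0 z).
  (* Room for w around |z|, and a radius r beyond it, so that the difference quotient is bounded by
     one [K] on |w| <= rho. *)
  set (rho := (1 + Cmod z) / 2). set (r := (1 + rho) / 2).
  assert (Hr : 0 <= rho < r /\ r < 1) by (unfold r, rho; lra).
  destruct (disk_coefs_quo z u Hz Hu r) as [M HM]; [lra|].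
  set (K := 2 * (M / (1 - rho / r))).
  exists (Rmin (rho - Cmod z) (eps / (Rabs K + 1))).
  pose proof (Rabs_pos K). split.
  - apply Rmin_pos; [unfold rho; lra|apply Rdiv_lt_0_compat; lra].
  - intros w Hw Hd.
    pose proof (Rmin_l (rho - Cmod z) (eps / (Rabs K + 1))).
    pose proof (Rmin_r (rho - Cmod z) (eps / (Rabs K + 1))).
    pose proof (Cmod_add (Csub w z) z) as T. replace (Cadd (Csub w z) z) with w in T by ring.
    destruct (ev_bound (quo z u) rho r M w) as [_ B]; [lra|exact HM|lra|]. fold K in B.
    rewrite ev_increment, Cmod_mul by assumption.
    pose proof (Cmod_ge0 (Csub w z)); pose proof (Rle_abs K).
    apply Rle_lt_trans with (Cmod (Csub w z) * (Rabs K + 1)).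
    + apply Rmult_le_compat_l; lra.
    + replace eps with (eps / (Rabs K + 1) * (Rabs K + 1)) by (field; lra).
      apply Rmult_lt_compat_r; lra.
Qed.

Lemma ev_holomorphic (u : nat -> Cx) : disk_coefs u -> holomorphic_on_D (ev u).
Proof.
  intros Hu z Hz; exists (ev (quo z u) z); intros eps He.
  destruct (ev_continuous (quo z u) z (disk_coefs_quo z u Hz Hu) Hz eps He) as [d [Hd H]].
  exists d; split; [exact Hd|]. intros w Hw [H1 H2].
  rewrite ev_increment by assumption.
  replace (Cdiv (Cmul (Csub w z) (ev (quo z u) w)) (Csub w z)) with (ev (quo z u) w).
  - apply H; assumption.
  - field. intros E; rewrite E, Cmod_C0 in H1; lra.
Qed.

Lemma ev_0 (u : nat -> Cx) : disk_coefs u -> ev u C0 = u 0%nat.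
Proof.
  intros Hu; pose proof (ev_drop 0 u C0 Hu inD_C0) as E.
  change (drop_seq 0 u) with u in E. rewrite E; ring.
Qed.

(** The value at 0 is the constant coefficient; once it is dropped, the remaining series vanishes
    away from 0 after division by z, and at 0 by continuity. *)
Lemma ev_eq0_coefs (u : nat -> Cx) : disk_coefs u -> (forall z, inD z -> ev u z = C0) ->
  forall n, u n = C0.
Proof.
  intros Hu H n; revert u Hu H; induction n; intros u Hu H.
  - rewrite <- ev_0 by exact Hu; apply H, inD_C0.
  - apply (IHn (drop_seq 1 u)); [apply disk_coefs_drop, Hu|].
    assert (Hn : forall z, inD z -> z <> C0 -> ev (drop_seq 1 u) z = C0).
    { intros z Hz Hz0; apply (Cmul_cancel_l z); [exact Hz0|].
      pose proof (ev_drop 0 u z Hu Hz) as E. change (drop_seq 0 u) with u in E.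
      rewrite <- (ev_0 u Hu) in E. rewrite !H in E by (try apply inD_C0; assumption).
      replace (Cmul z (ev (drop_seq 1 u) z)) with (Cadd C0 (Cmul z (ev (drop_seq 1 u) z))) by ring.
      symmetry; exact E. }
    intros z Hz; destruct (Cx_eq_dec z C0) as [->|Hz0]; [|apply Hn; assumption].
    apply Cmod_eq0. destruct (Cmod_ge0 (ev (drop_seq 1 u) C0)) as [G|G]; [exfalso|auto].
    destruct (ev_continuous (drop_seq 1 u) C0 (disk_coefs_drop 1 u Hu) inD_C0 _ G) as [d [Hd K]].
    (* A nonzero real point inside the disk and closer to 0 than d. *)
    set (x := Rmin d 1 / 2). assert (Hx : 0 < x < 1 /\ x < d).
    { unfold x; pose proof (Rmin_l d 1); pose proof (Rmin_r d 1).
      assert (0 < Rmin d 1) by (apply Rmin_pos; lra). lra. }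
    assert (Ex : Cmod (RtoC x) = x) by (apply Cmod_RtoC; lra).
    assert (Dx : inD (RtoC x)) by (unfold inD; rewrite Ex; lra).
    specialize (K (RtoC x) Dx).
    rewrite (Hn (RtoC x) Dx) in K by (apply RtoC_neq0; lra).
    replace (Csub (RtoC x) C0) with (RtoC x) in K by ring. rewrite Ex in K.
    replace (Csub C0 (ev (drop_seq 1 u) C0)) with (Copp (ev (drop_seq 1 u) C0)) in K by ring.
    rewrite Cmod_opp in K. specialize (K ltac:(lra)); lra.
Qed.

Lemma infinite_sum_terms_bounded (u : nat -> R) (l : R) :
  infinite_sum u l -> exists M, forall n, Rabs (u n) <= M.
Proof.
  intros H. destruct (maj_by_pos (sum_f_R0 u)) as [M [HM B]]; [exists l; exact H|].
  exists (2 * M); intros [|n].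
  - specialize (B 0%nat); simpl in B; lra.
  - pose proof (B n) as B1; pose proof (B (S n)) as B2; simpl in B2.
    replace (u (S n)) with (sum_f_R0 u n + u (S n) + - sum_f_R0 u n) by ring.
    eapply Rle_trans; [apply Rabs_triang|]. rewrite Rabs_Ropp; lra.
Qed.

Lemma disk_coefs_represents (u : nat -> Cx) (f : Cx -> Cx) : represents u f -> disk_coefs u.
Proof.
  intros H r Hr. assert (Er : Cmod (RtoC r) = r) by (apply Cmod_RtoC; lra).
  destruct (H (RtoC r)) as [H1 H2]; [unfold inD; rewrite Er; lra|].
  apply infinite_sum_terms_bounded in H1, H2.
  destruct H1 as [M HM]; destruct H2 as [N HN]; exists (M + N); intros n.
  rewrite <- Er, <- Cmod_pow, <- Cmod_mul. eapply Rle_trans; [apply Cmod_le_Re_Im|].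
  specialize (HM n); specialize (HN n); lra.
Qed.

Lemma represents_ev (u : nat -> Cx) (f : Cx -> Cx) : represents u f -> forall z, inD z -> ev u z = f z.
Proof. intros H z Hz; apply ev_unique, H, Hz. Qed.

Lemma ev_represents (u : nat -> Cx) (f : Cx -> Cx) : disk_coefs u ->
  (forall z, inD z -> ev u z = f z) -> represents u f.
Proof. intros Hu H z Hz; rewrite <- H by exact Hz; apply ev_cv; assumption. Qed.

(** Identifies sequences that are known only through [represents], such as the approximants in
    [in_Hb]. *)
Lemma ev_inj (u v : nat -> Cx) : disk_coefs u -> disk_coefs v ->
  (forall z, inD z -> ev u z = ev v z) -> u = v.
Proof.
  intros Hu Hv H; apply functional_extensionality; intros n.
  assert (E : sub_seq u v n = C0).
  { revert n; apply ev_eq0_coefs; [apply disk_coefs_sub; assumption|].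
    intros z Hz; rewrite sub_seqE, ev_add, ev_scal, H; try assumption; [ring|].
    apply disk_coefs_scal, Hv. }
  replace (u n) with (Cadd (sub_seq u v n) (v n)) by (unfold sub_seq; ring). rewrite E; ring.
Qed.

Definition poly_coefs (p : list Cx) (n : nat) : Cx := nth n p C0.

Lemma disk_coefs_poly (p : list Cx) : disk_coefs (poly_coefs p).
Proof.
  induction p as [|a p IH]; intros r Hr.
  - exists 0; intros n; unfold poly_coefs; destruct n; simpl; rewrite Cmod_C0; lra.
  - destruct (IH r Hr) as [M HM]; exists (Rmax (Cmod a) M); intros [|n].
    + unfold poly_coefs; simpl; rewrite Rmult_1_r; apply Rmax_l.
    + eapply Rle_trans; [|apply Rmax_r]. eapply Rle_trans; [|apply (HM n)].
      unfold poly_coefs; simpl. apply Rmult_le_compat_l; [apply Cmod_ge0|].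
      assert (0 <= r ^ n) by (apply pow_le; lra). nra.
Qed.

Lemma ev_poly (p : list Cx) (z : Cx) : inD z -> ev (poly_coefs p) z = Peval p z.
Proof.
  intros Hz; induction p as [|a p IH].
  - apply ev_unique. apply (Csum_cv_ext (fun _ => C0)); [|apply Csum_cv_0].
    intros [|n]; unfold poly_coefs; simpl; ring.
  - pose proof (ev_drop 0 (poly_coefs (a :: p)) z (disk_coefs_poly _) Hz) as E.
    change (drop_seq 0 (poly_coefs (a :: p))) with (poly_coefs (a :: p)) in E.
    change (drop_seq 1 (poly_coefs (a :: p))) with (poly_coefs p) in E.
    rewrite E, IH; reflexivity.
Qed.

(** * Orders of vanishing *)

Lemma der_add (u v : nat -> Cx) : der (add_seq u v) = add_seq (der u) (der v).
Proof. apply functional_extensionality; intros n; unfold der, add_seq; ring. Qed.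

Lemma der_scal (c : Cx) (u : nat -> Cx) : der (scal_seq c u) = scal_seq c (der u).
Proof. apply functional_extensionality; intros n; unfold der, scal_seq; ring. Qed.

Lemma RtoC_INR_S (n : nat) : RtoC (INR (S n)) = Cadd (RtoC (INR n)) C1.
Proof. rewrite S_INR; apply Cx_eq; simpl; ring. Qed.

Lemma der_mul_lin (a b : Cx) (u : nat -> Cx) :
  der (mul_lin a b u) = add_seq (mul_lin a b (der u)) (scal_seq b u).
Proof.
  apply functional_extensionality; intros n; unfold der, mul_lin, add_seq, scal_seq.
  destruct n as [|n]; cbn [shift].
  - apply Cx_eq; simpl; ring.
  - rewrite (RtoC_INR_S (S n)); ring.
Qed.

(** Leibniz rule: for a factor of degree one only two terms survive. *)
Lemma dern_mul_lin (a b : Cx) (u : nat -> Cx) (l : nat) :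
  dern (S l) (mul_lin a b u) =
  add_seq (mul_lin a b (dern (S l) u)) (scal_seq (Cmul (RtoC (INR (S l))) b) (dern l u)).
Proof.
  induction l.
  - simpl dern; rewrite der_mul_lin. f_equal. apply functional_extensionality; intros n.
    unfold scal_seq; apply Cx_eq; simpl; ring.
  - change (dern (S (S l)) (mul_lin a b u)) with (der (dern (S l) (mul_lin a b u))).
    rewrite IHl, der_add, der_scal, der_mul_lin.
    apply functional_extensionality; intros n; unfold add_seq, scal_seq. simpl dern.
    rewrite (RtoC_INR_S (S l)).
    ring.
Qed.

Definition Dv (l : nat) (u : nat -> Cx) (z : Cx) : Cx := ev (dern l u) z.

Lemma Dv_mul_lin (l : nat) (a b : Cx) (u : nat -> Cx) (z : Cx) : disk_coefs u -> inD z ->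
  Dv (S l) (mul_lin a b u) z =
  Cadd (Cmul (Cadd a (Cmul b z)) (Dv (S l) u z)) (Cmul (Cmul (RtoC (INR (S l))) b) (Dv l u z)).
Proof.
  intros Hu Hz; unfold Dv; rewrite dern_mul_lin.
  pose proof (disk_coefs_dern l u Hu) as H1; pose proof (disk_coefs_dern (S l) u Hu) as H2.
  rewrite ev_add, ev_scal, ev_mul_lin; try assumption; [reflexivity| |].
  - apply disk_coefs_mul_lin, H2.
  - apply disk_coefs_scal, H1.
Qed.

Lemma dern_add (l : nat) (u v : nat -> Cx) : dern l (add_seq u v) = add_seq (dern l u) (dern l v).
Proof. induction l; simpl; [reflexivity|rewrite IHl, der_add; reflexivity]. Qed.

Lemma dern_scal (l : nat) (c : Cx) (u : nat -> Cx) : dern l (scal_seq c u) = scal_seq c (dern l u).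
Proof. induction l; simpl; [reflexivity|rewrite IHl, der_scal; reflexivity]. Qed.

Lemma Dv_add (l : nat) (u v : nat -> Cx) (z : Cx) : disk_coefs u -> disk_coefs v -> inD z ->
  Dv l (add_seq u v) z = Cadd (Dv l u z) (Dv l v z).
Proof. intros; unfold Dv; rewrite dern_add; apply ev_add; try apply disk_coefs_dern; assumption. Qed.

Lemma Dv_scal (l : nat) (c : Cx) (u : nat -> Cx) (z : Cx) : disk_coefs u -> inD z ->
  Dv l (scal_seq c u) z = Cmul c (Dv l u z).
Proof. intros; unfold Dv; rewrite dern_scal; apply ev_scal; try apply disk_coefs_dern; assumption. Qed.

Lemma dernE (l : nat) (u : nat -> Cx) (n : nat) :
  dern l u n = Cmul (RtoC (INR (fact (n + l)) / INR (fact n))) (u (n + l)%nat).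
Proof.
  revert n; induction l; intros n.
  - rewrite Nat.add_0_r; simpl. replace (INR (fact n) / INR (fact n)) with 1.
    + apply Cx_eq; simpl; ring.
    + field; apply INR_fact_neq_0.
  - simpl dern; unfold der; rewrite IHl.
    replace (S n + l)%nat with (n + S l)%nat by lia.
    replace (INR (fact (n + S l)) / INR (fact n))
      with (INR (S n) * (INR (fact (n + S l)) / INR (fact (S n)))).
    + rewrite RtoC_mul; ring.
    + rewrite (fact_simpl n), mult_INR. pose proof (INR_fact_neq_0 n).
      field; split; [assumption|]. apply not_0_INR; lia.
Qed.

Definition vanish (m : nat) (z : Cx) (u : nat -> Cx) : Prop :=
  forall l, (l < m)%nat -> Dv l u z = C0.

(** The second Leibniz term is a multiple of the derivative of order m - 1, which is zero; the first
    nonvanishing derivative is simply scaled by the factor. *)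
Lemma Dv_mul_lin_vanish (m : nat) (a b : Cx) (u : nat -> Cx) (z : Cx) : disk_coefs u -> inD z ->
  vanish m z u -> Dv m (mul_lin a b u) z = Cmul (Cadd a (Cmul b z)) (Dv m u z).
Proof.
  intros Hu Hz H; destruct m; [apply ev_mul_lin; assumption|].
  rewrite Dv_mul_lin by assumption. rewrite (H m) by lia. ring.
Qed.

Lemma vanish_mul_lin (m : nat) (a b : Cx) (u : nat -> Cx) (z : Cx) : disk_coefs u -> inD z ->
  vanish m z u -> vanish m z (mul_lin a b u).
Proof.
  intros Hu Hz H l Hl. rewrite Dv_mul_lin_vanish; try assumption.
  - rewrite H by exact Hl; ring.
  - intros k Hk; apply H; lia.
Qed.

Lemma Dv_mul_lin_root (m : nat) (a b : Cx) (u : nat -> Cx) (z : Cx) : disk_coefs u -> inD z ->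
  Cadd a (Cmul b z) = C0 -> Dv (S m) (mul_lin a b u) z = Cmul (Cmul (RtoC (INR (S m))) b) (Dv m u z).
Proof. intros Hu Hz H; rewrite Dv_mul_lin, H by assumption; ring. Qed.

Lemma vanish_mul_lin_root (m : nat) (a b : Cx) (u : nat -> Cx) (z : Cx) : disk_coefs u -> inD z ->
  Cadd a (Cmul b z) = C0 -> vanish m z u -> vanish (S m) z (mul_lin a b u).
Proof.
  intros Hu Hz H0 H [|l] Hl.
  - unfold Dv; simpl; rewrite ev_mul_lin, H0 by assumption; ring.
  - rewrite Dv_mul_lin_root by assumption. rewrite H by lia; ring.
Qed.

Lemma vanish_mul_lin_inv (m : nat) (a b : Cx) (u : nat -> Cx) (z : Cx) : disk_coefs u -> inD z ->
  Cadd a (Cmul b z) <> C0 -> vanish m z (mul_lin a b u) -> vanish m z u.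
Proof.
  intros Hu Hz H0 H; induction m; [intros l Hl; lia|].
  assert (V : vanish m z u) by (apply IHm; intros l Hl; apply H; lia).
  intros l Hl; destruct (Nat.eq_dec l m) as [->|Hne]; [|apply V; lia].
  apply (Cmul_cancel_l _ _ H0). rewrite <- Dv_mul_lin_vanish by assumption. apply H; lia.
Qed.

Lemma vanish_mul_lin_root_inv (m : nat) (a b : Cx) (u : nat -> Cx) (z : Cx) : disk_coefs u -> inD z ->
  Cadd a (Cmul b z) = C0 -> b <> C0 -> vanish (S m) z (mul_lin a b u) -> vanish m z u.
Proof.
  intros Hu Hz H0 Hb H l Hl. apply (Cmul_cancel_l (Cmul (RtoC (INR (S l))) b)).
  - apply Cmul_neq0; [|exact Hb]. apply RtoC_neq0, not_0_INR; lia.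
  - rewrite <- (Dv_mul_lin_root l a b u z) by assumption. apply H; lia.
Qed.

Lemma vanish_div_lin (m : nat) (l : Cx) (u : nat -> Cx) (z : Cx) : disk_coefs u -> inD l -> inD z ->
  vanish m z u -> vanish m z (div_lin (Cconj l) u).
Proof.
  intros Hu Hl Hz H. apply (vanish_mul_lin_inv m C1 (Copp (Cconj l))); try assumption.
  - apply disk_coefs_div_lin; [unfold inD; rewrite Cmod_conj|]; assumption.
  - apply Blaschke_denominator_neq0; assumption.
  - rewrite mul_lin_div_lin; exact H.
Qed.

Lemma Dv_div_lin_vanish (m : nat) (l : Cx) (u : nat -> Cx) (z : Cx) : disk_coefs u -> inD l -> inD z ->
  vanish m z u ->
  Dv m (div_lin (Cconj l) u) z = Cmul (Cinv (Cadd C1 (Cmul (Copp (Cconj l)) z))) (Dv m u z).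
Proof.
  intros Hu Hl Hz H. pose proof (Blaschke_denominator_neq0 l z Hl Hz) as H0.
  rewrite <- (mul_lin_div_lin (Cconj l) u) at 2.
  rewrite Dv_mul_lin_vanish; try assumption.
  - field; exact H0.
  - apply disk_coefs_div_lin; [unfold inD; rewrite Cmod_conj|]; assumption.
  - apply vanish_div_lin; assumption.
Qed.

(** * Products of linear factors and of Blaschke factors *)

(** Multiplicities are encoded by repetition in the list, so that every argument adds or removes one
    factor at a time. *)
Definition mul_roots (L : list Cx) (u : nat -> Cx) : nat -> Cx :=
  fold_right (fun l v => mul_lin (Copp l) C1 v) u L.

Definition mul_blaschke (L : list Cx) (u : nat -> Cx) : nat -> Cx :=
  fold_right (fun l v => mul_lin (Copp l) C1 (div_lin (Cconj l) v)) u L.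

Lemma disk_coefs_mul_roots (L : list Cx) (u : nat -> Cx) : disk_coefs u -> disk_coefs (mul_roots L u).
Proof. intros Hu; induction L; simpl; [exact Hu|apply disk_coefs_mul_lin, IHL]. Qed.

Lemma disk_coefs_mul_blaschke (L : list Cx) (u : nat -> Cx) : (forall l, In l L -> inD l) ->
  disk_coefs u -> disk_coefs (mul_blaschke L u).
Proof.
  intros HL Hu; induction L as [|l L IH]; simpl; [exact Hu|].
  apply disk_coefs_mul_lin, disk_coefs_div_lin.
  - unfold inD; rewrite Cmod_conj; apply HL; left; reflexivity.
  - apply IH; intros; apply HL; right; assumption.
Qed.

(** The constant [k] is chosen before [u]. For products this independence is what finally makes E(u
    b) a fixed multiple of u(0). *)
Lemma Dv_mul_root (l z : Cx) (m : nat) : inD z -> exists k, k <> C0 /\ forall u,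
  disk_coefs u -> vanish m z u ->
  let m' := if Cx_eq_dec l z then S m else m in
  vanish m' z (mul_lin (Copp l) C1 u) /\ Dv m' (mul_lin (Copp l) C1 u) z = Cmul k (Dv m u z).
Proof.
  intros Hz; destruct (Cx_eq_dec l z) as [->|Hne].
  - exists (Cmul (RtoC (INR (S m))) C1); split.
    + apply Cmul_neq0; [apply RtoC_neq0, not_0_INR; lia|]. intros H; injection H; lra.
    + intros u Hu H; split.
      * apply vanish_mul_lin_root; try assumption; ring.
      * apply Dv_mul_lin_root; try assumption; ring.
  - exists (Cadd (Copp l) (Cmul C1 z)); split.
    + replace (Cadd (Copp l) (Cmul C1 z)) with (Csub z l) by ring.
      apply Csub_neq0; auto.
    + intros u Hu H; split; [apply vanish_mul_lin|apply Dv_mul_lin_vanish]; assumption.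
Qed.

Lemma count_occ_step (l z : Cx) (L : list Cx) (m : nat) :
  (m + count_occ Cx_eq_dec (l :: L) z)%nat =
  (if Cx_eq_dec l z then S (m + count_occ Cx_eq_dec L z) else m + count_occ Cx_eq_dec L z)%nat.
Proof. simpl; destruct (Cx_eq_dec l z); lia. Qed.

Lemma Dv_mul_roots (L : list Cx) (z : Cx) (m : nat) : inD z -> exists k, k <> C0 /\ forall u,
  disk_coefs u -> vanish m z u ->
  let m' := (m + count_occ Cx_eq_dec L z)%nat in
  vanish m' z (mul_roots L u) /\ Dv m' (mul_roots L u) z = Cmul k (Dv m u z).
Proof.
  intros Hz; induction L as [|l L [k [Hk H]]].
  - exists C1; split; [intros E; injection E; lra|]. intros u Hu Hv; simpl.
    rewrite Nat.add_0_r; split; [exact Hv|ring].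
  - destruct (Dv_mul_root l z (m + count_occ Cx_eq_dec L z) Hz) as [k' [Hk' H']].
    exists (Cmul k' k); split; [apply Cmul_neq0; assumption|]. intros u Hu Hv.
    rewrite count_occ_step. destruct (H u Hu Hv) as [V E].
    destruct (H' (mul_roots L u) (disk_coefs_mul_roots L u Hu) V) as [V' E'].
    split; [exact V'|]. etransitivity; [exact E'|]. rewrite E; ring.
Qed.

Lemma Dv_mul_blaschke (L : list Cx) (z : Cx) (m : nat) : (forall l, In l L -> inD l) -> inD z ->
  exists k, k <> C0 /\ forall u, disk_coefs u -> vanish m z u ->
  let m' := (m + count_occ Cx_eq_dec L z)%nat in
  vanish m' z (mul_blaschke L u) /\ Dv m' (mul_blaschke L u) z = Cmul k (Dv m u z).
Proof.
  intros HL Hz; induction L as [|l L IH].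
  - exists C1; split; [intros E; injection E; lra|]. intros u Hu Hv; simpl.
    rewrite Nat.add_0_r; split; [exact Hv|ring].
  - destruct IH as [k [Hk H]]; [intros; apply HL; right; assumption|].
    assert (Hl : inD l) by (apply HL; left; reflexivity).
    assert (HL' : forall l, In l L -> inD l) by (intros; apply HL; right; assumption).
    destruct (Dv_mul_root l z (m + count_occ Cx_eq_dec L z) Hz) as [k' [Hk' H']].
    pose proof (Blaschke_denominator_neq0 l z Hl Hz) as Hd.
    exists (Cmul k' (Cmul (Cinv (Cadd C1 (Cmul (Copp (Cconj l)) z))) k)); split.
    + repeat apply Cmul_neq0; try assumption. intros E; apply Hd.
      set (d := Cadd C1 (Cmul (Copp (Cconj l)) z)) in *.
      exfalso. assert (F : C1 = C0).
      { replace C1 with (Cmul (Cinv d) d) by (field; exact Hd). rewrite E; ring. }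
      injection F; lra.
    + intros u Hu Hv. rewrite count_occ_step. destruct (H u Hu Hv) as [V E].
      pose proof (disk_coefs_mul_blaschke L u HL' Hu) as Du.
      destruct (H' (div_lin (Cconj l) (mul_blaschke L u))) as [V' E'].
      * apply disk_coefs_div_lin; [unfold inD; rewrite Cmod_conj|]; assumption.
      * apply vanish_div_lin; assumption.
      * split; [exact V'|]. etransitivity; [exact E'|].
        rewrite Dv_div_lin_vanish, E by assumption. ring.
Qed.

Definition blaschke_list (L : list Cx) (z : Cx) : Cx :=
  fold_right (fun l w => Cmul (Cdiv (Csub z l) (Csub C1 (Cmul (Cconj l) z))) w) C1 L.

Lemma ev_mul_blaschke (L : list Cx) (u : nat -> Cx) (z : Cx) : (forall l, In l L -> inD l) ->
  disk_coefs u -> inD z -> ev (mul_blaschke L u) z = Cmul (ev u z) (blaschke_list L z).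
Proof.
  intros HL Hu Hz; induction L as [|l L IH]; simpl; [ring|].
  assert (Hl : inD l) by (apply HL; left; reflexivity).
  assert (HL' : forall l, In l L -> inD l) by (intros; apply HL; right; assumption).
  pose proof (disk_coefs_mul_blaschke L u HL' Hu) as Du.
  pose proof (Blaschke_denominator_neq0 l z Hl Hz) as Hd.
  rewrite ev_mul_lin, ev_div_lin, IH; try assumption.
  - replace (Csub C1 (Cmul (Cconj l) z)) with (Cadd C1 (Cmul (Copp (Cconj l)) z)) by ring.
    field; exact Hd.
  - apply disk_coefs_div_lin; [unfold inD; rewrite Cmod_conj|]; assumption.
Qed.

Lemma div_lin_add (m : Cx) (u v : nat -> Cx) :
  div_lin m (add_seq u v) = add_seq (div_lin m u) (div_lin m v).
Proof.
  apply functional_extensionality; intros n; induction n; [reflexivity|].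
  unfold add_seq, scal_seq in *; simpl; rewrite IHn; ring.
Qed.

Lemma div_lin_scal (m c : Cx) (u : nat -> Cx) :
  div_lin m (scal_seq c u) = scal_seq c (div_lin m u).
Proof.
  apply functional_extensionality; intros n; induction n; [reflexivity|].
  unfold add_seq, scal_seq in *; simpl; rewrite IHn; ring.
Qed.

Lemma mul_lin_add (a b : Cx) (u v : nat -> Cx) :
  mul_lin a b (add_seq u v) = add_seq (mul_lin a b u) (mul_lin a b v).
Proof.
  apply functional_extensionality; intros [|n]; unfold mul_lin, add_seq; simpl; ring.
Qed.

Lemma mul_lin_scal (a b c : Cx) (u : nat -> Cx) :
  mul_lin a b (scal_seq c u) = scal_seq c (mul_lin a b u).
Proof.
  apply functional_extensionality; intros [|n]; unfold mul_lin, scal_seq; simpl; ring.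
Qed.

Lemma mul_blaschke_add (L : list Cx) (u v : nat -> Cx) :
  mul_blaschke L (add_seq u v) = add_seq (mul_blaschke L u) (mul_blaschke L v).
Proof.
  induction L; simpl; [reflexivity|]. rewrite IHL, div_lin_add, mul_lin_add; reflexivity.
Qed.

Lemma mul_blaschke_scal (L : list Cx) (c : Cx) (u : nat -> Cx) :
  mul_blaschke L (scal_seq c u) = scal_seq c (mul_blaschke L u).
Proof.
  induction L; simpl; [reflexivity|]. rewrite IHL, div_lin_scal, mul_lin_scal; reflexivity.
Qed.

Lemma mul_blaschke_sub (L : list Cx) (u v : nat -> Cx) :
  mul_blaschke L (sub_seq u v) = sub_seq (mul_blaschke L u) (mul_blaschke L v).
Proof. rewrite !sub_seqE, mul_blaschke_add, mul_blaschke_scal; reflexivity. Qed.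

(** * Weighted square summability *)

Lemma eventually_decreasing_bounded (x : nat -> R) (N : nat) :
  (forall n, (N <= n)%nat -> x (S n) <= x n) -> exists C, forall n, x n <= C.
Proof.
  revert x; induction N; intros x H.
  - exists (x 0%nat); intros n; induction n; [lra|]. specialize (H n ltac:(lia)); lra.
  - destruct (IHN (fun n => x (S n))) as [C HC]; [intros n Hn; apply H; lia|].
    exists (Rmax (x 0%nat) C); intros [|n]; [apply Rmax_l|].
    eapply Rle_trans; [apply HC|apply Rmax_r].
Qed.

Lemma weight_ratio (om : nat -> R) (e : R) : admissible_weight om -> 0 < e ->
  exists N, forall n, (N <= n)%nat -> (1 - e) * om n <= om (S n) <= (1 + e) * om n.
Proof.
  intros [Hp [_ Hl]] He; destruct (Hl e He) as [N HN]; exists N; intros n Hn.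
  specialize (HN n Hn); unfold Rdist in HN; apply Rabs_def2 in HN. specialize (Hp n).
  replace (om (S n)) with (om (S n) / om n * om n) by (field; lra).
  split; apply Rmult_le_compat_r; lra.
Qed.

Lemma weight_step (om : nat -> R) : admissible_weight om ->
  exists K, 0 <= K /\ forall n, om (S n) <= K * om n.
Proof.
  intros Hom; destruct Hom as [Hp [H1 Hl]].
  destruct (maj_by_pos (fun n => om (S n) / om n)) as [K [HK B]]; [exists 1; exact Hl|].
  exists K; split; [lra|]; intros n; specialize (B n); specialize (Hp n).
  apply Rmult_le_reg_r with (/ om n); [apply Rinv_0_lt_compat, Hp|].
  replace (K * om n * / om n) with K by (field; lra).
  eapply Rle_trans; [apply Rle_abs|exact B].
Qed.

(** The ratio of consecutive weights is eventually at least q, so q^n / om_n eventually decreases.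
    [weight_upper] is the mirror image, with ratios at most 1/q. *)
Lemma weight_lower (om : nat -> R) (q : R) : admissible_weight om -> 0 < q < 1 ->
  exists C, forall n, q ^ n <= C * om n.
Proof.
  intros Hom Hq; destruct (weight_ratio om (1 - q) Hom) as [N HN]; [lra|].
  destruct Hom as [Hp _].
  destruct (eventually_decreasing_bounded (fun n => q ^ n / om n) N) as [C HC].
  - intros n Hn; destruct (HN n Hn) as [H _]. pose proof (Hp n); pose proof (Hp (S n)).
    apply Rmult_le_reg_r with (om n * om (S n)); [nra|].
    simpl. replace (q * q ^ n / om (S n) * (om n * om (S n))) with (q ^ n * (q * om n)) by (field; lra).
    replace (q ^ n / om n * (om n * om (S n))) with (q ^ n * om (S n)) by (field; lra).
    apply Rmult_le_compat_l; [apply pow_le; lra|lra].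
  - exists C; intros n; specialize (HC n); pose proof (Hp n).
    replace (q ^ n) with (q ^ n / om n * om n) by (field; lra).
    apply Rmult_le_compat_r; lra.
Qed.

Lemma weight_upper (om : nat -> R) (q : R) : admissible_weight om -> 0 < q < 1 ->
  exists C, forall n, om n * q ^ n <= C.
Proof.
  intros Hom Hq.
  assert (Hi : 1 < / q) by (rewrite <- Rinv_1; apply Rinv_lt_contravar; lra).
  destruct (weight_ratio om (/ q - 1) Hom) as [N HN]; [lra|].
  apply (eventually_decreasing_bounded _ N).
  intros n Hn; destruct (HN n Hn) as [_ H]. destruct Hom as [Hp _]; pose proof (Hp n).
  simpl. replace (om n * q ^ n) with ((1 + (/ q - 1)) * om n * (q * q ^ n)) by (field; lra).
  apply Rmult_le_compat_r; [|exact H]. apply Rmult_le_pos; [lra|apply pow_le; lra].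
Qed.

(** Partial sums of the squared norm, so that operator bounds can be stated before any convergence
    is known. *)
Definition energy (om : nat -> R) (u : nat -> Cx) (N : nat) : R :=
  sum_f_R0 (fun n => om n * Cnorm2 (u n)) N.

Lemma energy_term_ge0 (om : nat -> R) (u : nat -> Cx) (n : nat) : admissible_weight om ->
  0 <= om n * Cnorm2 (u n).
Proof. intros [Hp _]; specialize (Hp n); pose proof (Cnorm2_ge0 (u n)); nra. Qed.

Lemma energy_le_norm2 (om : nat -> R) (u : nat -> Cx) (v : R) (N : nat) : admissible_weight om ->
  has_norm2 om u v -> energy om u N <= v.
Proof.
  intros Hom H; apply (sum_incr (fun n => om n * Cnorm2 (u n))); [exact H|].
  intros; apply energy_term_ge0, Hom.
Qed.

Lemma norm2_of_energy_bound (om : nat -> R) (u : nat -> Cx) (V : R) : admissible_weight om ->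
  (forall N, energy om u N <= V) -> exists v, has_norm2 om u v /\ v <= V.
Proof.
  intros Hom H. destruct (growing_cv (energy om u)) as [v Hv].
  - intros n; unfold energy; simpl. pose proof (energy_term_ge0 om u (S n) Hom); lra.
  - exists V; intros x [n ->]; apply H.
  - exists v; split; [exact Hv|].
    apply (is_lim_seq_le (energy om u) (fun _ => V) v V H); [|apply is_lim_seq_const].
    apply is_lim_seq_Reals; exact Hv.
Qed.

Lemma energy_term_le (om : nat -> R) (u : nat -> Cx) (N : nat) : admissible_weight om ->
  om N * Cnorm2 (u N) <= energy om u N.
Proof.
  intros Hom; destruct N; unfold energy; simpl; [lra|].
  pose proof (cond_pos_sum (fun n => om n * Cnorm2 (u n)) N) as G.
  assert (0 <= sum_f_R0 (fun n => om n * Cnorm2 (u n)) N)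
    by (apply G; intros; apply energy_term_ge0, Hom). lra.
Qed.

Lemma inH2_disk_coefs (om : nat -> R) (u : nat -> Cx) : admissible_weight om ->
  inH2 om u -> disk_coefs u.
Proof.
  intros Hom [v Hv] r Hr.
  destruct (weight_lower om (r * r) Hom) as [C HC]; [nra|].
  exists (1 + Rabs C * v); intros n.
  pose proof (energy_term_le om u n Hom) as B. pose proof (energy_le_norm2 om u v n Hom Hv) as B'.
  (* A bound A on the square of a nonnegative number gives the bound 1 + A on the number, without a
     square root. *)
  assert (Hx : (Cmod (u n) * r ^ n) * (Cmod (u n) * r ^ n) <= Rabs C * v).
  { replace ((Cmod (u n) * r ^ n) * (Cmod (u n) * r ^ n)) with (Cmod (u n) * Cmod (u n) * (r * r) ^ n)
      by (rewrite Rpow_mult_distr; ring).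
    rewrite Cmod_sqr. pose proof (Cnorm2_ge0 (u n)).
    apply Rle_trans with (Cnorm2 (u n) * (Rabs C * om n)).
    - apply Rmult_le_compat_l; [assumption|]. eapply Rle_trans; [apply HC|].
      apply Rmult_le_compat_r; [apply Rlt_le, Hom|apply Rle_abs].
    - replace (Cnorm2 (u n) * (Rabs C * om n)) with (Rabs C * (om n * Cnorm2 (u n))) by ring.
      apply Rmult_le_compat_l; [apply Rabs_pos|lra]. }
  set (x := Cmod (u n) * r ^ n) in *. nra.
Qed.

(** For small t the loss falls on [z], while the factor of [w] stays close to 1; [w] will be the
    term that must contract. *)
Lemma Cnorm2_add_le (t : R) (z w : Cx) : 0 < t ->
  Cnorm2 (Cadd z w) <= (1 + / t) * Cnorm2 z + (1 + t) * Cnorm2 w.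
Proof.
  intros Ht. assert (E : forall a b, (a + b) * (a + b) <= (1 + / t) * (a * a) + (1 + t) * (b * b)).
  { intros a b. pose proof (Rinv_0_lt_compat t Ht) as Hi.
    assert (H : 0 <= / t * ((a - t * b) * (a - t * b)))
      by (apply Rmult_le_pos; [lra|apply (Rle_0_sqr (a - t * b))]).
    replace (/ t * ((a - t * b) * (a - t * b))) with (/ t * (a * a) - 2 * a * b + t * (b * b)) in H
      by (field; lra). lra. }
  pose proof (E (Re z) (Re w)); pose proof (E (Im z) (Im w)). unfold Cnorm2; simpl; lra.
Qed.

Lemma Cnorm2_mul (z w : Cx) : Cnorm2 (Cmul z w) = Cnorm2 z * Cnorm2 w.
Proof. unfold Cnorm2; simpl; ring. Qed.

(** * Causal operators *)

(** The same N on both sides: the bound holds for all sequences, composes directly, and gives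
    boundedness on H^2_omega in the limit. *)
Definition causally_bounded (om : nat -> R) (T : (nat -> Cx) -> nat -> Cx) : Prop :=
  exists C, 0 <= C /\ forall u N, energy om (T u) N <= C * energy om u N.

Lemma causally_bounded_comp (om : nat -> R) (S T : (nat -> Cx) -> nat -> Cx) :
  causally_bounded om S -> causally_bounded om T -> causally_bounded om (fun u => S (T u)).
Proof.
  intros [C [HC HS]] [D [HD HT]]; exists (C * D); split; [nra|]. intros u N.
  eapply Rle_trans; [apply HS|]. rewrite Rmult_assoc. apply Rmult_le_compat_l; [exact HC|apply HT].
Qed.

Lemma causally_bounded_inH2 (om : nat -> R) (T : (nat -> Cx) -> nat -> Cx) (u : nat -> Cx) :
  admissible_weight om -> causally_bounded om T -> inH2 om u -> inH2 om (T u).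
Proof.
  intros Hom [C [HC HT]] [v Hv].
  destruct (norm2_of_energy_bound om (T u) (C * v) Hom) as [w [Hw _]]; [|exists w; exact Hw].
  intros N; eapply Rle_trans; [apply HT|]. apply Rmult_le_compat_l; [exact HC|].
  apply energy_le_norm2; assumption.
Qed.

Lemma causally_bounded_mul_lin (om : nat -> R) (a b : Cx) : admissible_weight om ->
  causally_bounded om (mul_lin a b).
Proof.
  intros Hom; destruct (weight_step om Hom) as [K [HK HS]].
  set (A := 2 * Cnorm2 a). set (B := 2 * Cnorm2 b * K).
  assert (HA : 0 <= A) by (unfold A; pose proof (Cnorm2_ge0 a); lra).
  assert (HB : 0 <= B) by (unfold B; pose proof (Cnorm2_ge0 b); nra).
  exists (A + B); split; [lra|]. intros u N.
  (* The extra term pays in advance for the contribution that [u N], moved by the shift, makes at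
     the next index. *)
  assert (G : energy om (mul_lin a b u) N + B * (om N * Cnorm2 (u N)) <= (A + B) * energy om u N).
  { induction N.
    - unfold energy, mul_lin; simpl. pose proof (energy_term_ge0 om u 0 Hom).
      replace (Cadd (Cmul a (u 0%nat)) (Cmul b C0)) with (Cmul a (u 0%nat)) by ring.
      rewrite Cnorm2_mul. unfold A in *. pose proof (Cnorm2_ge0 a). nra.
    - unfold energy in *; simpl sum_f_R0.
      pose proof (Cnorm2_add_le 1 (Cmul a (u (S N))) (Cmul b (u N)) Rlt_0_1) as T.
      rewrite Rinv_1, !Cnorm2_mul in T.
      change (mul_lin a b u (S N)) with (Cadd (Cmul a (u (S N))) (Cmul b (u N))).
      assert (Q : om (S N) * Cnorm2 (Cadd (Cmul a (u (S N))) (Cmul b (u N))) <=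
                  A * (om (S N) * Cnorm2 (u (S N))) + B * (om N * Cnorm2 (u N))).
      { apply Rle_trans with (om (S N) * ((1 + 1) * (Cnorm2 a * Cnorm2 (u (S N)))
                                + (1 + 1) * (Cnorm2 b * Cnorm2 (u N)))).
        - apply Rmult_le_compat_l; [apply Rlt_le, Hom|exact T].
        - specialize (HS N). assert (0 <= Cnorm2 b * Cnorm2 (u N))
            by (apply Rmult_le_pos; apply Cnorm2_ge0).
          unfold A, B. nra. }
      nra. }
  pose proof (energy_term_ge0 om u N Hom). nra.
Qed.

(** Up to a fixed index no contraction is available. The constant may grow with [N0], but it is
    uniform in [e] and [f], as an operator bound requires. *)
Lemma causal_recursion_bound_init (C1 K : R) (N0 : nat) : 0 <= C1 -> 0 <= K ->
  exists C, 0 <= C /\ forall e f : nat -> R, (forall n, 0 <= e n) -> (forall n, 0 <= f n) ->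
    e 0%nat <= C1 * f 0%nat -> (forall n, e (S n) <= C1 * f (S n) + K * e n) ->
    forall N, (N <= N0)%nat -> sum_f_R0 e N <= C * sum_f_R0 f N.
Proof.
  intros H1 HK; induction N0.
  - exists C1; split; [exact H1|]. intros e f He Hf H0 H N HN.
    replace N with 0%nat by lia; exact H0.
  - destruct IHN0 as [C [HC IH]]. exists ((1 + K) * C + C1); split; [nra|].
    intros e f He Hf H0 H N HN.
    assert (Sf : 0 <= sum_f_R0 f N) by (apply cond_pos_sum; exact Hf).
    destruct (Nat.eq_dec N (S N0)) as [->|Hne].
    + pose proof (IH e f He Hf H0 H N0 (le_n _)) as G. specialize (H N0).
      assert (E : e N0 <= sum_f_R0 e N0).
      { destruct N0; simpl; [lra|]. pose proof (cond_pos_sum e N0 He); lra. }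
      simpl. pose proof (cond_pos_sum f N0 Hf). pose proof (Hf (S N0)).
      assert (0 <= (1 + K) * C * f (S N0)) by (repeat apply Rmult_le_pos; lra).
      assert (K * e N0 <= K * sum_f_R0 e N0) by (apply Rmult_le_compat_l; lra).
      assert ((1 + K) * sum_f_R0 e N0 <= (1 + K) * (C * sum_f_R0 f N0)) by (apply Rmult_le_compat_l; lra).
      nra.
    + eapply Rle_trans; [apply (IH e f He Hf H0 H N); lia|].
      apply Rmult_le_compat_r; [exact Sf|]. pose proof (Rmult_le_pos K C HK HC); lra.
Qed.

Lemma causal_recursion_bound (C1 K rho : R) (N0 : nat) : 0 <= C1 -> 0 <= K -> 0 <= rho < 1 ->
  exists C, 0 <= C /\ forall e f : nat -> R, (forall n, 0 <= e n) -> (forall n, 0 <= f n) ->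
    e 0%nat <= C1 * f 0%nat -> (forall n, e (S n) <= C1 * f (S n) + K * e n) ->
    (forall n, (N0 <= n)%nat -> e (S n) <= C1 * f (S n) + rho * e n) ->
    forall N, sum_f_R0 e N <= C * sum_f_R0 f N.
Proof.
  intros H1 HK Hr; destruct (causal_recursion_bound_init C1 K N0 H1 HK) as [C [HC B]].
  (* Chosen so that (1 + A) rho = A: with [A * e] added to the partial sum, the part rho e_n passed
     on to the next index is exactly covered, and the induction closes. *)
  set (A := rho / (1 - rho)).
  assert (HA : 0 <= A) by (apply Rle_mult_inv_pos; lra).
  assert (EA : (1 + A) * rho = A) by (unfold A; field; lra).
  exists ((1 + A) * (C + C1)); split; [nra|].
  intros e f He Hf H0 HS HR N.
  destruct (Nat.le_gt_cases N N0) as [HN|HN].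
  { eapply Rle_trans; [apply (B e f He Hf H0 HS N HN)|].
    apply Rmult_le_compat_r; [apply cond_pos_sum, Hf|].
    pose proof (Rmult_le_pos A (C + C1) HA ltac:(lra)); lra. }
  assert (G : forall k, sum_f_R0 e (k + N0) + A * e (k + N0)%nat <=
                        (1 + A) * (C + C1) * sum_f_R0 f (k + N0)).
  { induction k.
    - simpl. specialize (B e f He Hf H0 HS N0 (le_n _)). pose proof (cond_pos_sum f N0 Hf).
      assert (E : e N0 <= sum_f_R0 e N0).
      { destruct N0; simpl; [lra|]. pose proof (cond_pos_sum e N0 He); lra. }
      apply Rle_trans with ((1 + A) * sum_f_R0 e N0).
      { pose proof (Rmult_le_compat_l A _ _ HA E); lra. }
      rewrite Rmult_assoc; apply Rmult_le_compat_l; [lra|].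
      pose proof (Rmult_le_pos C1 _ H1 H); lra.
    - simpl. specialize (HR (k + N0)%nat ltac:(lia)). pose proof (Hf (S (k + N0))).
      assert ((1 + A) * e (S (k + N0)) <= (1 + A) * C1 * f (S (k + N0)) + A * e (k + N0)%nat).
      { rewrite <- EA at 3. nra. }
      assert (0 <= (1 + A) * C * f (S (k + N0))) by (repeat apply Rmult_le_pos; lra).
      nra. }
  specialize (G (N - N0)%nat). replace (N - N0 + N0)%nat with N in G by lia.
  pose proof (He N). nra.
Qed.

(** With p = |l|^2, one factor 1 + t is spent on splitting a square by [Cnorm2_add_le], the other on
    the ratio of the weights. *)
Lemma contraction_slack (p : R) : 0 <= p < 1 -> exists t, 0 < t < 1 /\ (1 + t) * (1 + t) * p < 1.
Proof. intros Hp; exists ((1 - p) / 4); split; [lra|nra]. Qed.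

Lemma Cnorm2_inD (m : Cx) : inD m -> 0 <= Cnorm2 m < 1.
Proof.
  unfold inD; intros H; split; [apply Cnorm2_ge0|]. rewrite <- Cmod_sqr.
  pose proof (Cmod_ge0 m); nra.
Qed.

Lemma causally_bounded_div_lin (om : nat -> R) (m : Cx) : admissible_weight om -> inD m ->
  causally_bounded om (div_lin m).
Proof.
  intros Hom Hm; apply Cnorm2_inD in Hm.
  destruct (contraction_slack _ Hm) as [t [Ht Hr]].
  destruct (weight_step om Hom) as [K [HK HS]].
  destruct (weight_ratio om t Hom) as [N0 HN]; [lra|].
  assert (Hi : 0 < / t) by (apply Rinv_0_lt_compat; lra).
  (* The factor with [K] holds at every index but need not be below 1; the contracting one holds
     from [N0] on. *)
  destruct (causal_recursion_bound (1 + / t) ((1 + t) * Cnorm2 m * K)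
              ((1 + t) * (1 + t) * Cnorm2 m) N0) as [C [HC B]].
  - lra.
  - repeat apply Rmult_le_pos; lra.
  - split; [repeat apply Rmult_le_pos; lra|exact Hr].
  - exists C; split; [exact HC|]. intros u N; apply B.
    + intros; apply energy_term_ge0, Hom.
    + intros; apply energy_term_ge0, Hom.
    + simpl. pose proof (energy_term_ge0 om u 0 Hom). nra.
    + intros n. simpl div_lin.
      pose proof (Cnorm2_add_le t (u (S n)) (Cmul m (div_lin m u n)) (proj1 Ht)) as T.
      rewrite Cnorm2_mul in T. specialize (HS n).
      assert (0 <= (1 + t) * Cnorm2 m * Cnorm2 (div_lin m u n))
        by (repeat apply Rmult_le_pos; try apply Cnorm2_ge0; lra).
      assert (0 < om (S n)) by apply Hom.
      eapply Rle_trans; [apply Rmult_le_compat_l; [lra|exact T]|]. nra.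
    + intros n Hn. simpl div_lin.
      pose proof (Cnorm2_add_le t (u (S n)) (Cmul m (div_lin m u n)) (proj1 Ht)) as T.
      rewrite Cnorm2_mul in T. specialize (HN n Hn).
      assert (0 <= (1 + t) * Cnorm2 m * Cnorm2 (div_lin m u n))
        by (repeat apply Rmult_le_pos; try apply Cnorm2_ge0; lra).
      assert (0 < om (S n)) by apply Hom.
      eapply Rle_trans; [apply Rmult_le_compat_l; [lra|exact T]|]. nra.
Qed.

Lemma scal_seq_mul_lin (c : Cx) (u : nat -> Cx) : mul_lin c C0 u = scal_seq c u.
Proof. apply functional_extensionality; intros n; unfold mul_lin, scal_seq; ring. Qed.

Lemma causally_bounded_mul_blaschke (om : nat -> R) (L : list Cx) : admissible_weight om ->
  (forall l, In l L -> inD l) -> causally_bounded om (mul_blaschke L).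
Proof.
  intros Hom HL; induction L as [|l L IH]; simpl.
  - exists 1; split; [lra|]; intros; simpl; lra.
  - apply (causally_bounded_comp om (mul_lin (Copp l) C1)).
    + apply causally_bounded_mul_lin, Hom.
    + apply (causally_bounded_comp om (div_lin (Cconj l))).
      * apply causally_bounded_div_lin; [exact Hom|].
        unfold inD; rewrite Cmod_conj; apply HL; left; reflexivity.
      * apply IH; intros; apply HL; right; assumption.
Qed.

(** * Division by z - l and by Blaschke products *)

Lemma le_of_geometric_error (x H X s : R) : 0 <= s < 1 -> (forall k, x <= H + X * s ^ k) -> x <= H.
Proof.
  intros Hs B.
  apply (is_lim_seq_le (fun _ => x) (fun k => H + X * s ^ k) x H B); [apply is_lim_seq_const|].
  replace (Finite H) with (Finite (H + X * 0)) by (f_equal; ring).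
  apply is_lim_seq_plus'; [apply is_lim_seq_const|].
  apply is_lim_seq_mult'; [apply is_lim_seq_const|].
  apply is_lim_seq_geom; rewrite Rabs_pos_eq; lra.
Qed.

(* The subexponential growth of [e] discards the boundary term of the backward recursion. *)
Lemma anticausal_recursion_bound (C1 rho q F G : R) (N : nat) (e f : nat -> R) :
  0 <= C1 -> 0 <= rho < q -> q < 1 ->
  (forall n, 0 <= e n) -> (forall n, 0 <= f n) ->
  (forall n, sum_f_R0 f n <= F) -> (forall n, e n * q ^ n <= G) ->
  (forall n, (N <= n)%nat -> e n <= C1 * f (S n) + rho * e (S n)) ->
  exists V, forall M, sum_f_R0 e M <= V.
Proof.
  intros H1 Hrq Hq He Hf HF HG HR.
  assert (Hs : 0 <= rho / q < 1).
  { split; [apply Rle_mult_inv_pos; lra|]. apply Rmult_lt_reg_r with q; [lra|].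
    unfold Rdiv; rewrite Rmult_assoc, Rinv_l; lra. }
  (* The recursion iterated k times; the powers of rho in front of the terms of [f] are bounded by
     1. *)
  assert (A : forall k n, (N <= n)%nat ->
            e n <= C1 * (sum_f_R0 f (k + n) - sum_f_R0 f n) + rho ^ k * e (k + n)%nat).
  { induction k; intros n Hn; simpl; [lra|].
    specialize (IHk n Hn). specialize (HR (k + n)%nat ltac:(lia)).
    assert (0 <= rho ^ k <= 1) by (split; [apply pow_le|apply pow_le_1]; lra).
    assert (0 <= C1 * f (S (k + n))) by (apply Rmult_le_pos; [lra|apply Hf]).
    assert (rho ^ k * e (k + n)%nat <= rho ^ k * (C1 * f (S (k + n)) + rho * e (S (k + n))))
      by (apply Rmult_le_compat_l; [lra|exact HR]).
    nra. }
  assert (Sf : forall n, 0 <= sum_f_R0 f n) by (intros; apply cond_pos_sum, Hf).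
  assert (B : forall n, (N <= n)%nat -> e n <= C1 * F).
  { intros n Hn; apply (le_of_geometric_error _ _ (G / q ^ n) (rho / q)); [exact Hs|].
    intros k. eapply Rle_trans; [apply (A k n Hn)|]. apply Rplus_le_compat.
    - apply Rmult_le_compat_l; [exact H1|]. pose proof (HF (k + n)%nat); pose proof (Sf n); lra.
    - assert (0 < q ^ n) by (apply pow_lt; lra). assert (0 < q ^ k) by (apply pow_lt; lra).
      rewrite (Rpow_ratio rho q k) by lra.
      assert (0 <= (rho / q) ^ k) by (apply pow_le; lra).
      replace (q ^ k * (rho / q) ^ k * e (k + n)%nat)
        with (e (k + n)%nat * q ^ k * (rho / q) ^ k) by ring.
      apply Rmult_le_compat_r; [assumption|].
      apply Rmult_le_reg_r with (q ^ n); [assumption|].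
      replace (G / q ^ n * q ^ n) with G by (field; lra).
      rewrite Rmult_assoc, <- pow_add; apply HG. }
  (* The recursion summed over the indices from N + 1 to k + N: the shifted sum of [e] differs from
     the original by two boundary terms, and [B] bounds the one that enters with a plus sign. *)
  assert (T : forall k, (1 - rho) * (sum_f_R0 e (k + N) - sum_f_R0 e N) <=
             C1 * (sum_f_R0 f (S (k + N)) - sum_f_R0 f (S N)) + rho * (e (S (k + N)) - e (S N))).
  { induction k; simpl in *; [lra|]. specialize (HR (S (k + N)) ltac:(lia)). nra. }
  exists (sum_f_R0 e N + (C1 * F + rho * (C1 * F)) / (1 - rho)); intros M.
  assert (HF0 : 0 <= F) by (apply Rle_trans with (sum_f_R0 f 0); [apply Sf|apply HF]).
  assert (H0 : 0 <= C1 * F) by nra.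
  destruct (Nat.le_gt_cases M N) as [HM|HM].
  - assert (sum_f_R0 e M <= sum_f_R0 e N).
    { replace N with (N - M + M)%nat by lia.
      induction (N - M)%nat as [|j IH]; [simpl; lra|]. simpl. pose proof (He (S (j + M))); lra. }
    assert (0 <= (C1 * F + rho * (C1 * F)) / (1 - rho)) by (apply Rle_mult_inv_pos; nra). lra.
  - specialize (T (M - N)%nat). replace (M - N + N)%nat with M in T by lia.
    assert (sum_f_R0 e M - sum_f_R0 e N <= (C1 * F + rho * (C1 * F)) / (1 - rho)); [|lra].
    apply Rmult_le_reg_r with (1 - rho); [lra|].
    replace ((C1 * F + rho * (C1 * F)) / (1 - rho) * (1 - rho)) with (C1 * F + rho * (C1 * F))
      by (field; lra).
    pose proof (HF (S M)); pose proof (Sf (S N)). pose proof (B (S M) ltac:(lia)). pose proof (He (S N)).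
    nra.
Qed.

Lemma inH2_quo (om : nat -> R) (l : Cx) (u : nat -> Cx) : admissible_weight om -> inD l ->
  inH2 om u -> inH2 om (quo l u).
Proof.
  intros Hom Hl Hu.
  pose proof (inH2_disk_coefs om u Hom Hu) as Du.
  pose proof (disk_coefs_quo l u Hl Du) as Dc.
  destruct Hu as [v Hv].
  pose proof (Cnorm2_inD l Hl) as Hp.
  destruct (contraction_slack _ Hp) as [t [Ht Hr]].
  set (rho := (1 + t) * (1 + t) * Cnorm2 l) in *.
  assert (Hr0 : 0 <= rho) by (unfold rho; repeat apply Rmult_le_pos; lra).
  (* With x = (1 - rho)/4 one has r^3 = (1 - x)^3 > 1 - 4x = rho. Of the three factors r^n one is
     spent on the weight and two on the squared coefficient of the quotient. *)
  set (r := 1 - (1 - rho) / 4). assert (Hr1 : 0 < r < 1) by (unfold r; lra).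
  destruct (weight_upper om r Hom Hr1) as [C HC]. destruct (Dc r Hr1) as [M HM].
  (* Then 1 / (1 - d) = 1 + t, so that om_n <= (1 + t) om_{n+1} eventually. *)
  set (d := t / (1 + t)).
  assert (Hd : 0 < d < 1).
  { unfold d; split; [apply Rdiv_lt_0_compat; lra|].
    apply Rmult_lt_reg_r with (1 + t); [lra|]. unfold Rdiv; rewrite Rmult_assoc, Rinv_l; lra. }
  destruct (weight_ratio om d Hom) as [N HN]; [lra|].
  assert (Hi : 0 < / t) by (apply Rinv_0_lt_compat; lra).
  destruct (anticausal_recursion_bound ((1 + t) * (1 + / t)) rho (r * r * r) v (C * (M * M)) N
      (fun n => om n * Cnorm2 (quo l u n)) (fun n => om n * Cnorm2 (u n))) as [V HV].
  - repeat apply Rmult_le_pos; lra.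
  - split; [exact Hr0|]. unfold r. set (x := (1 - rho) / 4).
    replace rho with (1 - 4 * x) by (unfold x; field).
    assert (0 < x <= / 4) by (unfold x; lra). nra.
  - nra.
  - intros; apply energy_term_ge0, Hom.
  - intros; apply energy_term_ge0, Hom.
  - intros n; apply (energy_le_norm2 om u v n Hom Hv).
  - intros n. rewrite <- Cmod_sqr. specialize (HC n); specialize (HM n).
    assert (0 <= Cmod (quo l u n) * r ^ n) by (apply Rmult_le_pos; [apply Cmod_ge0|apply pow_le; lra]).
    replace (om n * (Cmod (quo l u n) * Cmod (quo l u n)) * (r * r * r) ^ n)
      with ((om n * r ^ n) * ((Cmod (quo l u n) * r ^ n) * (Cmod (quo l u n) * r ^ n)))
      by (rewrite !Rpow_mult_distr; ring).
    apply Rmult_le_compat; [| |exact HC|].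
    + apply Rmult_le_pos; [apply Rlt_le, Hom|apply pow_le; lra].
    + nra.
    + nra.
  - intros n Hn.
    assert (R1 : quo l u n = Cadd (u (S n)) (Cmul l (quo l u (S n)))).
    { apply (ev_drop (S n) u l Du Hl). }
    rewrite R1. pose proof (Cnorm2_add_le t (u (S n)) (Cmul l (quo l u (S n))) (proj1 Ht)) as T.
    rewrite Cnorm2_mul in T. destruct (HN n Hn) as [W _].
    assert (W' : om n <= (1 + t) * om (S n)).
    { replace (om n) with ((1 + t) * ((1 - d) * om n)) by (unfold d; field; lra).
      apply Rmult_le_compat_l; lra. }
    eapply Rle_trans; [apply Rmult_le_compat_l; [apply Rlt_le, Hom|exact T]|].
    replace ((1 + t) * (1 + / t) * (om (S n) * Cnorm2 (u (S n))) +
             rho * (om (S n) * Cnorm2 (quo l u (S n))))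
      with ((1 + t) * om (S n) * ((1 + / t) * Cnorm2 (u (S n)) +
             (1 + t) * (Cnorm2 l * Cnorm2 (quo l u (S n))))) by (unfold rho; ring).
    apply Rmult_le_compat_r; [|exact W'].
    apply Rplus_le_le_0_compat; repeat apply Rmult_le_pos; try apply Cnorm2_ge0; lra.
  - destruct (norm2_of_energy_bound om (quo l u) V Hom HV) as [w [Hw _]]. exists w; exact Hw.
Qed.

(** One zero is removed at a time: h / (z - l) stays in H^2_omega, and multiplying it by 1 - l^* z
    prepares the remaining division. The order drops by one at l and is unchanged elsewhere, just
    like the count in the tail of the list. *)
Lemma blaschke_division (om : nat -> R) (L : list Cx) (h : nat -> Cx) : admissible_weight om ->
  (forall l, In l L -> inD l) -> inH2 om h ->
  (forall z, In z L -> vanish (count_occ Cx_eq_dec L z) z h) ->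
  exists g, inH2 om g /\ mul_blaschke L g = h.
Proof.
  intros Hom; revert h; induction L as [|l L IH]; intros h HL Hh HV.
  - exists h; split; [exact Hh|reflexivity].
  - assert (Hl : inD l) by (apply HL; left; reflexivity).
    assert (Hcl : inD (Cconj l)) by (unfold inD; rewrite Cmod_conj; exact Hl).
    pose proof (inH2_disk_coefs om h Hom Hh) as Dh.
    assert (Vl : vanish (S (count_occ Cx_eq_dec L l)) l h).
    { pose proof (HV l (or_introl eq_refl)) as H. simpl in H.
      destruct (Cx_eq_dec l l); [exact H|congruence]. }
    assert (H0 : ev h l = C0) by (apply (Vl 0%nat); lia).
    pose proof (inH2_quo om l h Hom Hl Hh) as Hc.
    pose proof (disk_coefs_quo l h Hl Dh) as Dc.
    pose proof (mul_lin_quo l h Hl Dh H0) as Ec.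
    destruct (IH (mul_lin C1 (Copp (Cconj l)) (quo l h))) as [g [Hg Eg]].
    + intros; apply HL; right; assumption.
    + apply (causally_bounded_inH2 om (mul_lin C1 (Copp (Cconj l)))); try assumption.
      apply causally_bounded_mul_lin, Hom.
    + intros z Hz. assert (Dz : inD z) by (apply HL; right; exact Hz).
      apply vanish_mul_lin; try assumption.
      destruct (Cx_eq_dec l z) as [<-|Hne].
      * apply (vanish_mul_lin_root_inv _ (Copp l) C1); try assumption; [ring| |].
        -- intros X; injection X; lra.
        -- rewrite Ec; exact Vl.
      * apply (vanish_mul_lin_inv _ (Copp l) C1); try assumption.
        -- replace (Cadd (Copp l) (Cmul C1 z)) with (Csub z l) by ring. apply Csub_neq0; auto.
        -- rewrite Ec. pose proof (HV z (or_intror Hz)) as H. simpl in H.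
           destruct (Cx_eq_dec l z); [congruence|exact H].
    + exists g; split; [exact Hg|].
      change (mul_lin (Copp l) C1 (div_lin (Cconj l) (mul_blaschke L g)) = h); rewrite Eg.
      rewrite div_lin_mul_lin; exact Ec.
Qed.

(** * Approximation by polynomials *)

Definition truncation (g : nat -> Cx) (k : nat) : list Cx := map g (seq 0 k).

Lemma truncation_coefs (g : nat -> Cx) (k n : nat) :
  poly_coefs (truncation g k) n = if Nat.ltb n k then g n else C0.
Proof.
  unfold poly_coefs, truncation. destruct (Nat.ltb_spec n k) as [H|H].
  - rewrite (nth_indep _ C0 (g 0%nat)) by (rewrite length_map, length_seq; exact H).
    rewrite map_nth, seq_nth by exact H; reflexivity.
  - apply nth_overflow; rewrite length_map, length_seq; exact H.
Qed.

(** Pythagoras for disjoint index sets. The length is [S k] because [energy] includes the index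
    k. *)
Lemma energy_truncation (om : nat -> R) (g : nat -> Cx) (k j : nat) :
  energy om (sub_seq (poly_coefs (truncation g (S k))) g) (j + k) + energy om g k = energy om g (j + k).
Proof.
  induction j; simpl.
  - assert (E : energy om (sub_seq (poly_coefs (truncation g (S k))) g) k = 0); [|lra].
    unfold energy; rewrite (sum_eq _ (fun _ => 0)); [rewrite sum_cte; ring|].
    intros n Hn; unfold sub_seq; rewrite truncation_coefs.
    destruct (Nat.ltb_spec n (S k)); [|lia]. unfold Cnorm2; simpl; ring.
  - unfold energy in *; simpl sum_f_R0.
    assert (E : Cnorm2 (sub_seq (poly_coefs (truncation g (S k))) g (S (j + k))) = Cnorm2 (g (S (j + k)))).
    { unfold sub_seq; rewrite truncation_coefs.
      destruct (Nat.ltb_spec (S (j + k)) (S k)); [lia|]. unfold Cnorm2; simpl; ring. }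
    rewrite E; lra.
Qed.

Lemma energy_incr (om : nat -> R) (u : nat -> Cx) (N k : nat) : admissible_weight om ->
  energy om u N <= energy om u (N + k).
Proof.
  intros Hom; induction k; [rewrite Nat.add_0_r; lra|].
  rewrite Nat.add_succ_r. unfold energy in *; simpl.
  pose proof (energy_term_ge0 om u (S (N + k)) Hom); lra.
Qed.

Lemma energy_truncation_le (om : nat -> R) (g : nat -> Cx) (v : R) (k N : nat) : admissible_weight om ->
  has_norm2 om g v -> energy om (sub_seq (poly_coefs (truncation g (S k))) g) N <= v - energy om g k.
Proof.
  intros Hom Hv. set (w := sub_seq (poly_coefs (truncation g (S k))) g).
  apply Rle_trans with (energy om w (N + k)).
  - apply energy_incr, Hom.
  - pose proof (energy_truncation om g k N) as E. fold w in E.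
    pose proof (energy_le_norm2 om g v (N + k) Hom Hv); lra.
Qed.

Lemma Peval_truncation (g : nat -> Cx) (k : nat) (z : Cx) :
  Peval (truncation g k) z = Csum (fun n => Cmul (g n) (Cpow z n)) k.
Proof.
  unfold truncation.
  (* The starting index is generalised, since each Horner step moves it by one. *)
  assert (H : forall m, Peval (map g (seq m k)) z = Csum (fun n => Cmul (g (m + n)%nat) (Cpow z n)) k).
  { induction k; intros m; [reflexivity|]. rewrite Csum_recl. simpl seq; simpl map; simpl Peval.
    rewrite IHk, Nat.add_0_r, <- Csum_scal. simpl Cpow.
    f_equal; [ring|]. apply Csum_ext; intros i _. rewrite Nat.add_succ_r; simpl; ring. }
  apply H.
Qed.

Lemma Re_Csum (f : nat -> Cx) (n : nat) : Re (Csum f (S n)) = sum_f_R0 (fun k => Re (f k)) n.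
Proof. induction n; [simpl; ring|]. rewrite tech5, <- IHn; reflexivity. Qed.

Lemma Im_Csum (f : nat -> Cx) (n : nat) : Im (Csum f (S n)) = sum_f_R0 (fun k => Im (f k)) n.
Proof. induction n; [simpl; ring|]. rewrite tech5, <- IHn; reflexivity. Qed.

Lemma Csum_cv_Cmod (u : nat -> Cx) (l : Cx) (eps : R) : Csum_cv u l -> eps > 0 ->
  exists N, forall k, (N <= k)%nat -> Cmod (Csub (Csum u k) l) < eps.
Proof.
  intros [H1 H2] He. destruct (H1 (eps / 2) ltac:(lra)) as [N1 B1].
  destruct (H2 (eps / 2) ltac:(lra)) as [N2 B2].
  exists (S (N1 + N2)); intros [|k] Hk; [lia|].
  specialize (B1 k ltac:(lia)); specialize (B2 k ltac:(lia)). unfold Rdist in *.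
  eapply Rle_lt_trans; [apply Cmod_le_Re_Im|].
  rewrite <- Re_Csum in B1; rewrite <- Im_Csum in B2.
  unfold Csub; cbn [Re Im Cadd Copp]. unfold Rminus in *. lra.
Qed.

Lemma in_Hb_mul_blaschke (om : nat -> R) (L : list Cx) (b : Cx -> Cx) (g : nat -> Cx) :
  admissible_weight om -> (forall l, In l L -> inD l) -> (forall z, b z = blaschke_list L z) ->
  inH2 om g -> in_Hb om b (ev g) (mul_blaschke L g).
Proof.
  intros Hom HL Hb Hg.
  pose proof (inH2_disk_coefs om g Hom Hg) as Dg.
  destruct (causally_bounded_mul_blaschke om L Hom HL) as [C [HC HT]].
  split; [|split].
  - apply (causally_bounded_inH2 om (mul_blaschke L)); try assumption. exists C; split; assumption.
  - apply ev_represents; [apply disk_coefs_mul_blaschke; assumption|].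
    intros z Hz; rewrite Hb; apply ev_mul_blaschke; assumption.
  - destruct Hg as [v Hv].
    set (p := fun k => truncation g (S k)).
    set (hp := fun k => mul_blaschke L (poly_coefs (p k))).
    (* Defined through [Series], so that no sequence of limits has to be chosen. *)
    set (dist := fun k => Series (fun n => om n * Cnorm2 (Csub (hp k n) (mul_blaschke L g n)))).
    assert (Bd : forall k, has_norm2 om (sub_seq (hp k) (mul_blaschke L g)) (dist k) /\
                           dist k <= C * (v - energy om g k)).
    { intros k.
      destruct (norm2_of_energy_bound om (sub_seq (hp k) (mul_blaschke L g))
                  (C * (v - energy om g k)) Hom) as [w [Hw Bw]].
      - intros N; unfold hp; rewrite <- mul_blaschke_sub.
        eapply Rle_trans; [apply HT|]. apply Rmult_le_compat_l; [exact HC|].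
        apply energy_truncation_le; assumption.
      - replace (dist k) with w; [split; assumption|].
        symmetry; apply is_series_unique, is_series_Reals, Hw. }
    exists p, hp, dist; split; [|split; [|split]].
    + intros k; apply ev_represents.
      * apply disk_coefs_mul_blaschke; [assumption|apply disk_coefs_poly].
      * intros z Hz; unfold hp; rewrite Hb, ev_mul_blaschke, ev_poly; auto using disk_coefs_poly.
    + intros k; apply Bd.
    (* C + 1 instead of C, as C may be 0. *)
    + intros eps He. destruct (Hv (eps / (C + 1))) as [N HN]; [apply Rdiv_lt_0_compat; lra|].
      exists N; intros k Hk; specialize (HN k Hk). change (sum_f_R0 _ k) with (energy om g k) in HN.
      destruct (Bd k) as [Nk Bk]. pose proof (energy_le_norm2 om g v k Hom Hv) as Le.
      assert (0 <= dist k).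
      { apply Rle_trans with (energy om (sub_seq (hp k) (mul_blaschke L g)) 0).
        - apply energy_term_ge0, Hom.
        - apply energy_le_norm2; assumption. }
      unfold Rdist in *. rewrite Rabs_left1 in HN by lra.
      rewrite Rminus_0_r, Rabs_pos_eq by assumption.
      assert (X : (C + 1) * (v - energy om g k) < eps).
      { replace eps with ((C + 1) * (eps / (C + 1))) by (field; lra).
        apply Rmult_lt_compat_l; lra. }
      lra.
    + intros z Hz eps He.
      destruct (Csum_cv_Cmod _ _ eps (ev_cv g z Dg Hz) He) as [N HN].
      exists N; intros k Hk. unfold p; rewrite Peval_truncation. apply HN; lia.
Qed.

(** * The evaluation functional of a combination of kernels *)

(** The weight cancels the 1/om_n of the kernel and leaves the Taylor series of the derivative,
    preceded by l zero terms. Since lam is inside the disk this holds for every [h] with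
    [disk_coefs h], so the norm of [h] need not be known to be finite. *)
Lemma has_inner_kercoef (om : nat -> R) (lam : Cx) (l : nat) (h : nat -> Cx) : admissible_weight om ->
  disk_coefs h -> inD lam -> has_inner om h (kercoef om lam l) (Dv l h lam).
Proof.
  intros Hom Hh Hl; unfold has_inner. apply (Csum_cv_zeros l).
  - intros n Hn; unfold kercoef. destruct (Nat.leb_spec l n); [lia|].
    apply Cx_eq; simpl; ring.
  - apply (Csum_cv_ext (fun n => Cmul (dern l h n) (Cpow lam n))).
    + intros n; unfold kercoef. destruct (Nat.leb_spec l (n + l)); [|lia].
      replace (n + l - l)%nat with n by lia.
      rewrite dernE, Cconj_mul, Cconj_RtoC, Cconj_pow, Cconj_conj.
      assert (Hp : 0 < om (n + l)%nat) by apply Hom.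
      assert (E : RtoC (INR (fact (n + l)) / INR (fact n)) =
        Cmul (RtoC (om (n + l)%nat)) (RtoC (INR (fact (n + l)) / INR (fact n) / om (n + l)%nat))).
      { rewrite <- RtoC_mul; f_equal. pose proof (INR_fact_neq_0 n). field; split; lra. }
      rewrite E; ring.
    + apply ev_cv; [apply disk_coefs_dern|]; assumption.
Qed.

Lemma has_inner_scal_r (om : nat -> R) (h u : nat -> Cx) (c v : Cx) :
  has_inner om h u v -> has_inner om h (scal_seq c u) (Cmul (Cconj c) v).
Proof.
  intros H; unfold has_inner.
  apply (Csum_cv_ext (fun n => Cmul (Cconj c) (Cmul (RtoC (om n)) (Cmul (h n) (Cconj (u n)))))).
  - intros n; unfold scal_seq; rewrite Cconj_mul; ring.
  - apply Csum_cv_scal, H.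
Qed.

Lemma has_inner_Csum (om : nat -> R) (h : nat -> Cx) (u : nat -> nat -> Cx) (v : nat -> Cx) (n : nat) :
  (forall i, (i < n)%nat -> has_inner om h (u i) (v i)) ->
  has_inner om h (fun k => Csum (fun i => u i k) n) (Csum v n).
Proof.
  intros H; unfold has_inner.
  apply (Csum_cv_ext (fun k => Csum (fun i => Cmul (RtoC (om k)) (Cmul (h k) (Cconj (u i k)))) n)).
  - intros k; rewrite Csum_conj, <- !Csum_scal; reflexivity.
  - apply (Csum_cv_Csum (fun i k => Cmul (RtoC (om k)) (Cmul (h k) (Cconj (u i k))))), H.
Qed.

Definition kernel_combination (om : nat -> R) (pt : nat -> Cx) (ord : nat -> nat)
  (a : nat -> nat -> Cx) (n k : nat) : Cx :=
  Csum (fun i => Csum (fun l => Cmul (a i l) (kercoef om (pt i) l k)) (ord i)) n.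

(** The functional E of the overview. The coefficients are conjugated because the combination of
    kernels stands in the second slot; [ord i] counts the derivatives used, so the top order is
    [ord i - 1]. *)
Definition kernel_functional (pt : nat -> Cx) (ord : nat -> nat) (a : nat -> nat -> Cx) (n : nat)
  (h : nat -> Cx) : Cx :=
  Csum (fun i => Csum (fun l => Cmul (Cconj (a i l)) (Dv l h (pt i))) (ord i)) n.

Lemma has_inner_kernel_combination (om : nat -> R) (pt : nat -> Cx) (ord : nat -> nat)
  (a : nat -> nat -> Cx) (n : nat) (h : nat -> Cx) : admissible_weight om ->
  (forall i, (i < n)%nat -> inD (pt i)) -> disk_coefs h ->
  has_inner om h (kernel_combination om pt ord a n) (kernel_functional pt ord a n h).
Proof.
  intros Hom Hpt Hh; unfold kernel_combination, kernel_functional.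
  apply (has_inner_Csum om h
    (fun i k => Csum (fun l => Cmul (a i l) (kercoef om (pt i) l k)) (ord i))).
  intros i Hi. apply (has_inner_Csum om h (fun l k => Cmul (a i l) (kercoef om (pt i) l k))).
  intros l _. apply (has_inner_scal_r om h (kercoef om (pt i) l)).
  apply has_inner_kercoef; auto.
Qed.

Lemma kernel_functional_add (pt : nat -> Cx) (ord : nat -> nat) (a : nat -> nat -> Cx) (n : nat)
  (u v : nat -> Cx) : (forall i, (i < n)%nat -> inD (pt i)) -> disk_coefs u -> disk_coefs v ->
  kernel_functional pt ord a n (add_seq u v) =
  Cadd (kernel_functional pt ord a n u) (kernel_functional pt ord a n v).
Proof.
  intros Hpt Hu Hv; unfold kernel_functional; rewrite <- Csum_add.
  apply Csum_ext; intros i Hi; rewrite <- Csum_add. apply Csum_ext; intros l _.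
  rewrite Dv_add by auto; ring.
Qed.

Lemma kernel_functional_scal (pt : nat -> Cx) (ord : nat -> nat) (a : nat -> nat -> Cx) (n : nat)
  (c : Cx) (u : nat -> Cx) : (forall i, (i < n)%nat -> inD (pt i)) -> disk_coefs u ->
  kernel_functional pt ord a n (scal_seq c u) = Cmul c (kernel_functional pt ord a n u).
Proof.
  intros Hpt Hu; unfold kernel_functional; rewrite <- Csum_scal.
  apply Csum_ext; intros i Hi; rewrite <- Csum_scal. apply Csum_ext; intros l _.
  rewrite Dv_scal by auto; ring.
Qed.

(** * Orthogonality forces zeros *)

Fixpoint roots (pt : nat -> Cx) (ord : nat -> nat) (n : nat) : list Cx :=
  match n with O => nil | S k => repeat (pt k) (ord k) ++ roots pt ord k end.

Lemma In_roots (pt : nat -> Cx) (ord : nat -> nat) (n : nat) (z : Cx) :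
  In z (roots pt ord n) -> exists i, (i < n)%nat /\ z = pt i.
Proof.
  induction n; simpl; [tauto|]. rewrite in_app_iff; intros [H|H].
  - apply repeat_spec in H; exists n; split; [lia|exact H].
  - destruct (IHn H) as [i [Hi E]]; exists i; split; [lia|exact E].
Qed.

Lemma count_roots (pt : nat -> Cx) (ord : nat -> nat) (n i : nat) :
  (forall j k, (j < k < n)%nat -> pt j <> pt k) -> (i < n)%nat ->
  count_occ Cx_eq_dec (roots pt ord n) (pt i) = ord i.
Proof.
  induction n; intros Hd Hi; [lia|]. simpl; rewrite count_occ_app.
  assert (H0 : forall m z, (m <= n)%nat -> (forall j, (j < m)%nat -> pt j <> z) ->
                count_occ Cx_eq_dec (roots pt ord m) z = 0%nat).
  { intros m z Hm Hz; apply count_occ_not_In; intros H.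
    destruct (In_roots pt ord m z H) as [j [Hj E]]; apply (Hz j Hj); auto. }
  destruct (Nat.eq_dec i n) as [->|Hne].
  - rewrite count_occ_repeat_eq by reflexivity. rewrite H0; [lia|lia|].
    intros j Hj; apply Hd; lia.
  - rewrite count_occ_repeat_neq by (apply Hd; lia).
    simpl; apply IHn; [intros; apply Hd; lia|lia].
Qed.

Definition shift_orthogonal (pt : nat -> Cx) (ord : nat -> nat) (a : nat -> nat -> Cx) (n : nat)
  (u : nat -> Cx) : Prop :=
  forall m, kernel_functional pt ord a n (Nat.iter m shift u) = C0.

Lemma shift_mul_lin (a b : Cx) (u : nat -> Cx) (m : nat) :
  Nat.iter m shift (mul_lin a b u) = mul_lin a b (Nat.iter m shift u).
Proof.
  induction m; simpl; [reflexivity|]. rewrite IHm.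
  apply functional_extensionality; intros [|k]; unfold mul_lin; simpl; ring.
Qed.

Lemma disk_coefs_iter_shift (m : nat) (u : nat -> Cx) : disk_coefs u -> disk_coefs (Nat.iter m shift u).
Proof. intros H; induction m; simpl; [exact H|apply disk_coefs_shift, IHm]. Qed.

(** Requiring all shifts makes the property stable: E((z - l) z^m v) combines the conditions on v
    for m + 1 and for m. *)
Lemma shift_orthogonal_mul_roots (pt : nat -> Cx) (ord : nat -> nat) (a : nat -> nat -> Cx) (n : nat)
  (L : list Cx) (u : nat -> Cx) : (forall i, (i < n)%nat -> inD (pt i)) -> disk_coefs u ->
  shift_orthogonal pt ord a n u -> shift_orthogonal pt ord a n (mul_roots L u).
Proof.
  intros Hpt Hu H; induction L as [|l L IH]; [exact H|]. intros m; simpl.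
  pose proof (disk_coefs_iter_shift m _ (disk_coefs_mul_roots L u Hu)) as D.
  rewrite shift_mul_lin, mul_linE, kernel_functional_add, !kernel_functional_scal; try assumption.
  - rewrite (IH m). change (shift (Nat.iter m shift (mul_roots L u)))
      with (Nat.iter (S m) shift (mul_roots L u)). rewrite (IH (S m)); ring.
  - apply disk_coefs_shift, D.
  - apply disk_coefs_scal, D.
  - apply disk_coefs_scal, disk_coefs_shift, D.
Qed.

Lemma kernel_functional_top (pt : nat -> Cx) (ord : nat -> nat) (a : nat -> nat -> Cx) (n i m : nat)
  (v : nat -> Cx) : (i < n)%nat -> ord i = S m -> vanish m (pt i) v ->
  (forall j, (j < n)%nat -> j <> i -> vanish (ord j) (pt j) v) ->
  kernel_functional pt ord a n v = Cmul (Cconj (a i m)) (Dv m v (pt i)).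
Proof.
  intros Hi Ho Hv H; unfold kernel_functional. rewrite (Csum_only _ n i Hi).
  - rewrite Ho; rewrite (Csum_only _ (S m) m); [reflexivity|lia|].
    intros l Hl Hne; rewrite Hv by lia; ring.
  - intros j Hj Hne; apply Csum_eq0; intros l Hl; rewrite (H j Hj Hne l Hl); ring.
Qed.

(* Multiplying [u] by a polynomial that vanishes to full order at the other points, and to the order
   that is still missing at [pt i], isolates the top derivative in the functional. *)
Lemma shift_orthogonal_vanish (pt : nat -> Cx) (ord : nat -> nat) (a : nat -> nat -> Cx) (n : nat)
  (u : nat -> Cx) :
  (forall j k, (j < k < n)%nat -> pt j <> pt k) -> (forall i, (i < n)%nat -> inD (pt i)) ->
  (forall i m, (i < n)%nat -> ord i = S m -> a i m <> C0) ->
  disk_coefs u -> shift_orthogonal pt ord a n u ->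
  forall i, (i < n)%nat -> vanish (ord i) (pt i) u.
Proof.
  intros Hd Hpt Ha Hu H i Hi.
  assert (G : forall r, (r <= ord i)%nat -> vanish r (pt i) u); [|apply G; lia].
  induction r; intros Hr; [intros l Hl; lia|].
  specialize (IHr ltac:(lia)).
  intros l Hl; destruct (Nat.eq_dec l r) as [->|Hne]; [|apply IHr; lia].
  destruct (ord i) as [|m] eqn:Em; [lia|].
  set (L := roots pt (fun j => if Nat.eq_dec j i then m - r else ord j)%nat n).
  assert (Hc : forall j, (j < n)%nat -> count_occ Cx_eq_dec L (pt j)
                 = (if Nat.eq_dec j i then m - r else ord j)%nat).
  { intros j Hj; unfold L; rewrite count_roots by assumption; reflexivity. }
  destruct (Dv_mul_roots L (pt i) r (Hpt i Hi)) as [k [Hk K]].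
  destruct (K u Hu IHr) as [V E]. rewrite (Hc i Hi) in V, E.
  destruct (Nat.eq_dec i i); [|congruence].
  replace (r + (m - r))%nat with m in V, E by lia.
  pose proof (shift_orthogonal_mul_roots pt ord a n L u Hpt Hu H 0%nat) as Z; simpl in Z.
  rewrite (kernel_functional_top pt ord a n i m) in Z; try assumption.
  - rewrite E in Z. apply (Cmul_cancel_l k); [exact Hk|].
    apply (Cmul_cancel_l (Cconj (a i m))); [apply Cconj_neq0, Ha; assumption|exact Z].
  (* At the other points nothing is known about [u] yet, so the polynomial alone supplies the full
     order. *)
  - intros j Hj Hne. destruct (Dv_mul_roots L (pt j) 0 (Hpt j Hj)) as [k' [_ K']].
    destruct (K' u Hu) as [V' _]; [intros l' Hl'; lia|].
    rewrite (Hc j Hj) in V'. destruct (Nat.eq_dec j i); [congruence|exact V'].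
Qed.

(** * The reproducing kernel at the origin *)

(** The Blaschke product kills every derivative in the functional except one: at the origin the
    functional goes one order higher than the zero, and there the product has leading term a
    constant times u(0). *)
Lemma kernel_functional_mul_blaschke (pt : nat -> Cx) (ord : nat -> nat) (a : nat -> nat -> Cx) (n : nat) :
  (forall j k, (j < k < S n)%nat -> pt j <> pt k) -> (forall i, (i < S n)%nat -> inD (pt i)) ->
  pt 0%nat = C0 -> a 0%nat (ord 0%nat) <> C0 ->
  exists k, k <> C0 /\ forall u, disk_coefs u ->
    kernel_functional pt (fun i => match i with O => S (ord 0%nat) | S _ => ord i end) a (S n)
      (mul_blaschke (roots pt ord (S n)) u) = Cmul k (u 0%nat).
Proof.
  intros Hd Hpt H0 Ha. set (L := roots pt ord (S n)).
  assert (HL : forall l, In l L -> inD l).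
  { intros l Hl; destruct (In_roots pt ord (S n) l Hl) as [i [Hi ->]]; apply Hpt, Hi. }
  assert (Hc : forall i, (i < S n)%nat -> count_occ Cx_eq_dec L (pt i) = ord i)
    by (intros; apply count_roots; assumption).
  destruct (Dv_mul_blaschke L (pt 0%nat) 0 HL (Hpt 0%nat ltac:(lia))) as [k [Hk K]].
  exists (Cmul (Cconj (a 0%nat (ord 0%nat))) k); split.
  - apply Cmul_neq0; [apply Cconj_neq0, Ha|exact Hk].
  - intros u Hu. destruct (K u Hu) as [V E]; [intros l Hl; lia|].
    rewrite Hc in V, E by lia. simpl (0 + _)%nat in V, E.
    rewrite (kernel_functional_top _ _ _ _ 0 (ord 0%nat)); try assumption; [|lia|reflexivity|].
    + rewrite E. unfold Dv; simpl dern. rewrite H0, ev_0 by exact Hu. ring.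
    + intros j Hj Hne. destruct (Dv_mul_blaschke L (pt j) 0 HL (Hpt j Hj)) as [k' [_ K']].
      destruct (K' u Hu) as [V' _]; [intros l Hl; lia|].
      rewrite (Hc j Hj) in V'. destruct j; [congruence|exact V'].
Qed.

(** Young's inequality with a free parameter replaces Cauchy-Schwarz, since the norms are available
    as squares; taking t small while d is smaller still gives continuity. Treating real and
    imaginary parts separately doubles d/(2t) + te/2. *)
Lemma has_inner_bound (om : nat -> R) (u w : nat -> Cx) (d e t : R) (v : Cx) : admissible_weight om ->
  0 < t -> has_norm2 om u d -> has_norm2 om w e -> has_inner om u w v ->
  Cmod v <= d / t + t * e.
Proof.
  intros Hom Ht Hu Hw [H1 H2].
  pose proof (infinite_sum_lin (/ (2 * t)) (t / 2) _ _ _ _ Hu Hw) as S.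
  assert (Hi : 0 < / t) by (apply Rinv_0_lt_compat; exact Ht).
  assert (T : forall n, Cmod (Cmul (RtoC (om n)) (Cmul (u n) (Cconj (w n)))) <=
            / (2 * t) * (om n * Cnorm2 (u n)) + t / 2 * (om n * Cnorm2 (w n))).
  { intros n. assert (Hp : 0 < om n) by apply Hom.
    rewrite !Cmod_mul, Cmod_conj, Cmod_RtoC, <- !Cmod_sqr by lra.
    set (x := Cmod (u n)). set (y := Cmod (w n)).
    assert (Q : 0 <= om n * (/ (2 * t) * ((x - t * y) * (x - t * y)))).
    { apply Rmult_le_pos; [lra|]. apply Rmult_le_pos; [|apply (Rle_0_sqr (x - t * y))].
      apply Rlt_le, Rinv_0_lt_compat; lra. }
    replace (om n * (/ (2 * t) * ((x - t * y) * (x - t * y))))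
      with (/ (2 * t) * (om n * (x * x)) + t / 2 * (om n * (y * y)) - om n * (x * y)) in Q
      by (field; lra). lra. }
  assert (B1 : Rabs (Re v) <= / (2 * t) * d + t / 2 * e).
  { eapply infinite_sum_bound; [|exact H1|exact S|apply Rle_refl].
    intros n; eapply Rle_trans; [apply Re_le_Cmod|apply T]. }
  assert (B2 : Rabs (Im v) <= / (2 * t) * d + t / 2 * e).
  { eapply infinite_sum_bound; [|exact H2|exact S|apply Rle_refl].
    intros n; eapply Rle_trans; [apply Im_le_Cmod|apply T]. }
  pose proof (Cmod_le_Re_Im v).
  replace (d / t + t * e) with (2 * (/ (2 * t) * d + t / 2 * e)) by (field; lra). lra.
Qed.

Lemma kernel_functional_in_Hb (om : nat -> R) (pt : nat -> Cx) (ord : nat -> nat) (a : nat -> nat -> Cx)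
  (n : nat) (L : list Cx) (b : Cx -> Cx) (k : Cx) (f : Cx -> Cx) (h : nat -> Cx) :
  admissible_weight om -> (forall i, (i < n)%nat -> inD (pt i)) ->
  (forall l, In l L -> inD l) -> (forall z, b z = blaschke_list L z) ->
  has_norm2 om (kernel_combination om pt ord a n) 1 ->
  (forall u, disk_coefs u -> kernel_functional pt ord a n (mul_blaschke L u) = Cmul k (u 0%nat)) ->
  in_Hb om b f h -> kernel_functional pt ord a n h = Cmul k (f C0).
Proof.
  intros Hom Hpt HL Hb HB Hk [Hh [_ [p [hp [dist [Hrep [Hdist [Hcv Hpt0]]]]]]]].
  pose proof (inH2_disk_coefs om h Hom Hh) as Dh.
  set (D := Csub (kernel_functional pt ord a n h) (Cmul k (f C0))).
  (* With [dist j] below eps^2 and parameter t = eps, the inner product with B contributes at most 2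
     eps; the pointwise convergence at 0 contributes |k| eps. *)
  assert (B : forall eps, 0 < eps -> Cmod D <= (2 + Cmod k) * eps).
  { intros eps He.
    destruct (Hcv (eps * eps)) as [N1 HN1]; [nra|].
    destruct (Hpt0 C0 inD_C0 eps He) as [N2 HN2].
    set (j := (N1 + N2)%nat).
    specialize (HN1 j ltac:(unfold j; lia)); specialize (HN2 j ltac:(unfold j; lia)).
    specialize (Hdist j); specialize (Hrep j).
    pose proof (disk_coefs_represents _ _ Hrep) as Dj.
    assert (Dp : disk_coefs (poly_coefs (p j))) by apply disk_coefs_poly.
    (* The definition of [in_Hb] gives [hp j] only through the function it represents. *)
    assert (Ej : hp j = mul_blaschke L (poly_coefs (p j))).
    { apply ev_inj; [exact Dj|apply disk_coefs_mul_blaschke; assumption|].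
      intros z Hz; rewrite ev_mul_blaschke, ev_poly by assumption.
      rewrite (represents_ev _ _ Hrep z Hz), Hb; reflexivity. }
    assert (Fj : kernel_functional pt ord a n (hp j) = Cmul k (Peval (p j) C0)).
    { rewrite Ej, Hk, <- ev_0, ev_poly by (assumption || apply inD_C0); reflexivity. }
    assert (Ds : disk_coefs (sub_seq (hp j) h)) by (apply disk_coefs_sub; assumption).
    pose proof (has_inner_kernel_combination om pt ord a n _ Hom Hpt Ds) as I.
    pose proof (has_inner_bound om _ _ _ _ eps _ Hom He Hdist HB I) as Bd.
    rewrite sub_seqE, kernel_functional_add, kernel_functional_scal, Fj in Bd
      by (try apply disk_coefs_scal; assumption).
    assert (ED : D = Cadd (Copp (Cadd (Cmul k (Peval (p j) C0))
                                      (Cmul (Copp C1) (kernel_functional pt ord a n h))))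
                       (Cmul k (Csub (Peval (p j) C0) (f C0)))) by (unfold D; ring).
    rewrite ED. eapply Rle_trans; [apply Cmod_add|]. rewrite Cmod_opp, Cmod_mul.
    assert (Hd : dist j / eps <= eps).
    { apply Rmult_le_reg_r with eps; [exact He|].
      unfold Rdiv; rewrite Rmult_assoc, Rinv_l by lra.
      unfold Rdist in HN1; rewrite Rminus_0_r in HN1. pose proof (Rle_abs (dist j)); lra. }
    pose proof (Rmult_le_compat_l (Cmod k) _ _ (Cmod_ge0 k) (Rlt_le _ _ HN2)). lra. }
  assert (E0 : Cmod D = 0).
  { pose proof (Cmod_ge0 k) as Gk. destruct (Cmod_ge0 D) as [G|G]; [|auto].
    assert (Hx : 0 < Cmod D / (2 * (2 + Cmod k))) by (apply Rdiv_lt_0_compat; lra).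
    specialize (B _ Hx).
    replace ((2 + Cmod k) * (Cmod D / (2 * (2 + Cmod k)))) with (Cmod D / 2) in B by (field; lra). lra. }
  replace (kernel_functional pt ord a n h) with (Cadd D (Cmul k (f C0))) by (unfold D; ring).
  rewrite (Cmod_eq0 _ E0); ring.
Qed.

(** * Assembling the theorem *)

Lemma blaschke_list_app (L M : list Cx) (z : Cx) :
  blaschke_list (L ++ M) z = Cmul (blaschke_list L z) (blaschke_list M z).
Proof. induction L; simpl; [ring|]. rewrite IHL; ring. Qed.

Lemma blaschke_list_repeat (l z : Cx) (m : nat) :
  blaschke_list (repeat l m) z = Cpow (Cdiv (Csub z l) (Csub C1 (Cmul (Cconj l) z))) m.
Proof. induction m; simpl; [reflexivity|]. rewrite IHm; reflexivity. Qed.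

Lemma blaschke_roots (pt : nat -> Cx) (ord : nat -> nat) (s d0 : nat) (zs : nat -> Cx) (ms : nat -> nat)
  (z : Cx) : pt 0%nat = C0 -> ord 0%nat = d0 ->
  (forall i, pt (S i) = zs (S i)) -> (forall i, ord (S i) = ms (S i)) ->
  blaschke d0 s zs ms z = blaschke_list (roots pt ord (S s)) z.
Proof.
  intros Hp Ho Hps Hos; unfold blaschke; induction s.
  - simpl roots. rewrite app_nil_r, blaschke_list_repeat, Hp, Ho. simpl Cprod.
    (* The Blaschke factor of the point 0 is z itself, so the power z^d0 is part of the same
       list. *)
    replace (Cdiv (Csub z C0) (Csub C1 (Cmul (Cconj C0) z))) with z; [ring|].
    replace (Cconj C0) with C0 by (apply Cx_eq; simpl; ring).
    replace (Csub C1 (Cmul C0 z)) with C1 by ring.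
    field. intros E; injection E; lra.
  - change (roots pt ord (S (S s))) with (repeat (pt (S s)) (ord (S s)) ++ roots pt ord (S s)).
    rewrite blaschke_list_app, blaschke_list_repeat, <- IHs, Hps, Hos. simpl Cprod. ring.
Qed.

(** Finite choice by induction, used to pick the kernel coefficients of all the [F j] at once; the
    entry at 0 is prescribed, for the polynomial part. *)
Lemma bounded_choice (A : Type) (P : nat -> A -> Prop) (x0 : A) (s : nat) :
  (forall j, (1 <= j <= s)%nat -> exists x, P j x) ->
  exists f, f 0%nat = x0 /\ forall j, (1 <= j <= s)%nat -> P j (f j).
Proof.
  induction s; intros H.
  - exists (fun _ => x0); split; [reflexivity|]. intros; lia.
  - destruct IHs as [f [F0 Hf]]; [intros; apply H; lia|].
    destruct (H (S s)) as [x Hx]; [lia|].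
    exists (fun j => if Nat.eq_dec j (S s) then x else f j); split.
    + destruct (Nat.eq_dec 0 (S s)); [lia|exact F0].
    + intros j Hj; destruct (Nat.eq_dec j (S s)) as [->|]; [exact Hx|apply Hf; lia].
Qed.

(* K_0^(l) = l! z^l / om_l. *)
Lemma poly_kercoef (om : nat -> R) (p : list Cx) (d n : nat) : admissible_weight om -> length p = S d ->
  nth n p C0 =
  Csum (fun l => Cmul (Cmul (nth l p C0) (RtoC (om l / INR (fact l)))) (kercoef om C0 l n)) (S d).
Proof.
  intros Hom Hp.
  assert (K : forall l, l <> n -> kercoef om C0 l n = C0).
  { intros l Hl; unfold kercoef; destruct (Nat.leb_spec l n); [|reflexivity].
    destruct (n - l)%nat eqn:E; [lia|]. simpl Cpow.
    replace (Cconj C0) with C0 by (apply Cx_eq; simpl; ring). ring. }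
  destruct (Nat.lt_ge_cases n (S d)) as [H|H].
  - rewrite (Csum_only _ (S d) n H).
    + unfold kercoef; rewrite Nat.leb_refl, Nat.sub_diag.
      pose proof (INR_fact_neq_0 n). assert (Hn : 0 < om n) by apply Hom.
      assert (E : Cmul (RtoC (om n / INR (fact n))) (RtoC (INR (fact n) / INR (fact 0) / om n)) = C1).
      { rewrite <- RtoC_mul. replace (om n / INR (fact n) * (INR (fact n) / INR (fact 0) / om n)) with 1.
        - reflexivity.
        - simpl (INR (fact 0)). field. split; [lra|assumption]. }
      change (Cpow (Cconj C0) 0) with C1.
      transitivity (Cmul (nth n p C0)
        (Cmul (RtoC (om n / INR (fact n))) (RtoC (INR (fact n) / INR (fact 0) / om n)))); [rewrite E|]; ring.
    + intros l _ Hl; rewrite (K l Hl); ring.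
  - rewrite nth_overflow by lia. symmetry; apply Csum_eq0.
    intros l Hl; rewrite (K l) by lia; ring.
Qed.

Lemma shiftc_iter (m : nat) (u : nat -> Cx) : shiftc m u = Nat.iter m shift u.
Proof.
  induction m; apply functional_extensionality; intros n.
  - unfold shiftc; simpl; rewrite Nat.sub_0_r; reflexivity.
  - simpl; rewrite <- IHm. destruct n as [|n]; reflexivity.
Qed.

Theorem mainTheorem10
  (om : nat -> R) (Hom : admissible_weight om)
  (s : nat) (zs : nat -> Cx) (d0 : nat) (ms : nat -> nat)
  (Hzin : forall j, (1 <= j <= s)%nat -> inD (zs j))
  (Hz0 : forall j, (1 <= j <= s)%nat -> zs j <> C0)
  (Hzdist : forall i j, (1 <= i)%nat -> (i < j)%nat -> (j <= s)%nat -> zs i <> zs j)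
  (Hms : forall j, (1 <= j <= s)%nat -> (1 <= ms j)%nat)
  (f0 : list Cx) (Hf0len : length f0 = S d0) (Hf0deg : nth d0 f0 C0 <> C0)
  (F : nat -> nat -> Cx)
  (HF : forall j, (1 <= j <= s)%nat -> in_X_deg om (zs j) (ms j - 1) (F j))
  (Binner : H2_inner om (fun n => Cadd (nth n f0 C0) (Csum (fun i => F (S i) n) s))) :
  exists g : Cx -> Cx,
    holomorphic_on_D g /\
    represents (fun n => Cadd (nth n f0 C0) (Csum (fun i => F (S i) n) s))
               (fun z => Cmul (g z) (blaschke d0 s zs ms z)) /\
    (exists hg, in_Hb om (blaschke d0 s zs ms) g hg) /\
    exists (c : Cx) (k : Cx -> Cx) (hk : nat -> Cx),
      is_RK0_Hb om (blaschke d0 s zs ms) k hk /\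
      forall z, inD z -> g z = Cmul c (k z).
Proof.
  set (pt := fun i => match i with O => C0 | S _ => zs i end).
  (* [ordb] holds the orders of the zeros of b, [ordB] the numbers of kernel derivatives in B; they
     differ by one at the origin only. *)
  set (ordb := fun i => match i with O => d0 | S _ => ms i end).
  set (ordB := fun i => match i with O => S (ordb 0%nat) | S _ => ordb i end).
  destruct (bounded_choice (nat -> Cx)
     (fun j c => c (ms j - 1)%nat <> C0 /\
        forall n, F j n = Csum (fun l => Cmul (c l) (kercoef om (zs j) l n)) (S (ms j - 1)))
     (fun l => Cmul (nth l f0 C0) (RtoC (om l / INR (fact l)))) s HF) as [a [Ha0 Ha]].
  assert (Hpt : forall i, (i < S s)%nat -> inD (pt i)).
  { intros [|i] Hi; [apply inD_C0|apply Hzin; lia]. }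
  assert (Hd : forall j k, (j < k < S s)%nat -> pt j <> pt k).
  { intros [|j] [|k] Hjk; simpl; try lia.
    - apply not_eq_sym, Hz0; lia.
    - apply Hzdist; lia. }
  assert (Ha0d : a 0%nat d0 <> C0).
  { rewrite Ha0; apply Cmul_neq0; [exact Hf0deg|]. apply RtoC_neq0.
    assert (0 < om d0) by apply Hom. pose proof (INR_fact_lt_0 d0).
    apply Rgt_not_eq, Rdiv_lt_0_compat; assumption. }
  assert (HaB : forall i m, (i < S s)%nat -> ordB i = S m -> a i m <> C0).
  { intros [|i] m Hi Hm; simpl in Hm; [injection Hm as <-; exact Ha0d|].
    replace m with (ms (S i) - 1)%nat by lia. apply Ha; lia. }
  assert (EB : (fun n => Cadd (nth n f0 C0) (Csum (fun i => F (S i) n) s))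
               = kernel_combination om pt ordB a (S s)).
  { apply functional_extensionality; intros n; unfold kernel_combination.
    rewrite Csum_recl, Ha0, (poly_kercoef om f0 d0 n Hom Hf0len). f_equal.
    apply Csum_ext; intros i Hi. rewrite (proj2 (Ha (S i) ltac:(lia)) n).
    (* The truncated subtraction is harmless because every multiplicity is at least 1. *)
    replace (S (ms (S i) - 1)) with (ms (S i)) by (specialize (Hms (S i) ltac:(lia)); lia).
    reflexivity. }
  rewrite EB in Binner |- *. set (B := kernel_combination om pt ordB a (S s)) in *.
  destruct Binner as [HB1 HBorth].
  assert (HB : inH2 om B) by (exists 1; exact HB1).
  pose proof (inH2_disk_coefs om B Hom HB) as DB.
  (* Innerness gives orthogonality for m >= 1 only; these are all the shifts, from 0 on, of z B. *)
  assert (Orth : shift_orthogonal pt ordB a (S s) (shift B)).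
  { intros m. specialize (HBorth (S m) ltac:(lia)). rewrite shiftc_iter, Nat.iter_succ_r in HBorth.
    eapply Csum_cv_unique; [|exact HBorth].
    apply has_inner_kernel_combination; try assumption.
    apply disk_coefs_iter_shift, disk_coefs_shift, DB. }
  assert (Esh : shift B = mul_lin C0 C1 B).
  { apply functional_extensionality; intros n; unfold mul_lin; ring. }
  assert (Van : forall i, (i < S s)%nat -> vanish (ordb i) (pt i) B).
  { intros i Hi.
    pose proof (shift_orthogonal_vanish pt ordB a (S s) (shift B) Hd Hpt HaB
      (disk_coefs_shift B DB) Orth i Hi) as V.
    (* Back from z B to B: at the origin the factor z accounts for one order, at the other points it
       is nonzero and accounts for none. *)
    rewrite Esh in V. destruct i as [|i].
    - apply (vanish_mul_lin_root_inv _ C0 C1); try assumption; [apply inD_C0|simpl; ring|].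
      intros E; injection E; lra.
    - apply (vanish_mul_lin_inv _ C0 C1); try assumption; [apply Hpt, Hi|].
      replace (Cadd C0 (Cmul C1 (pt (S i)))) with (pt (S i)) by ring. apply Hz0; lia. }
  set (L := roots pt ordb (S s)).
  assert (HL : forall l, In l L -> inD l).
  { intros l Hl; destruct (In_roots _ _ _ _ Hl) as [i [Hi ->]]; apply Hpt, Hi. }
  assert (Hb : forall z, blaschke d0 s zs ms z = blaschke_list L z).
  { intros z; apply blaschke_roots; reflexivity. }
  destruct (blaschke_division om L B Hom HL HB) as [g [Hg Eg]].
  { intros z Hz; destruct (In_roots _ _ _ _ Hz) as [i [Hi ->]].
    unfold L; rewrite count_roots by assumption. apply Van, Hi. }
  pose proof (inH2_disk_coefs om g Hom Hg) as Dg.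
  destruct (kernel_functional_mul_blaschke pt ordb a s Hd Hpt eq_refl Ha0d) as [k [Hk K]].
  fold ordB in K. fold L in K.
  exists (ev g); split; [|split; [|split]].
  - apply ev_holomorphic, Dg.
  - apply ev_represents; [exact DB|]. intros z Hz.
    rewrite <- Eg, Hb; apply ev_mul_blaschke; assumption.
  - exists (mul_blaschke L g); apply in_Hb_mul_blaschke; assumption.
  - assert (Hck : Cconj k <> C0) by (apply Cconj_neq0, Hk).
    (* E(f b) = k f(0), and a scalar leaves the second slot conjugated; hence g / k^* reproduces the
       value at 0, and g is k^* times this kernel. *)
    set (q := Cinv (Cconj k)).
    assert (Hqg : inH2 om (scal_seq q g)).
    { rewrite <- (scal_seq_mul_lin q g).
      apply (causally_bounded_inH2 om (mul_lin q C0)); try assumption.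
      apply causally_bounded_mul_lin, Hom. }
    exists (Cconj k), (ev (scal_seq q g)), (mul_blaschke L (scal_seq q g)); split; [split|].
    + apply in_Hb_mul_blaschke; assumption.
    + intros f hf Hf. rewrite mul_blaschke_scal, Eg.
      pose proof (kernel_functional_in_Hb om pt ordB a (S s) L _ k f hf Hom Hpt HL Hb HB1 K Hf) as E.
      pose proof (inH2_disk_coefs om hf Hom (proj1 Hf)) as Dhf.
      pose proof (has_inner_kernel_combination om pt ordB a (S s) hf Hom Hpt Dhf) as I.
      apply (has_inner_scal_r om hf B q) in I. rewrite E in I.
      replace (f C0) with (Cmul (Cconj q) (Cmul k (f C0))); [exact I|].
      assert (Eq : Cmul (Cconj q) k = C1).
      { rewrite <- (Cconj_conj k), <- Cconj_mul. unfold q.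
        replace (Cmul (Cinv (Cconj k)) (Cconj k)) with C1 by (field; exact Hck).
        apply Cx_eq; simpl; ring. }
      transitivity (Cmul (Cmul (Cconj q) k) (f C0)); [ring|rewrite Eq; ring].
    + intros z Hz; rewrite ev_scal by assumption. unfold q. field; exact Hck.
Qed.
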